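(* The epi-corecursors $\mathit{cr}_i$, $i\in\{1,2,3,5,6,7,8,9\}$, defined in the context compare as follows with respect to expressiveness: $\mathit{cr}_2\equiv\mathit{cr}_5\geq\mathit{cr}_6\geq\mathit{cr}_3\equiv\mathit{cr}_1\geq\mathit{cr}_8$, and $\mathit{cr}_5\geq\mathit{cr}_9$, $\mathit{cr}_9\geq\mathit{cr}_7$, $\mathit{cr}_9\geq\mathit{cr}_8$.
   Context: **Epi-corecursors and strength.** An epi-corecursor is a tuple $\mathit{cr}=(\underline{\mathcal B},T,\underline{\mathcal C},J,R)$ where $\underline{\mathcal B}$ is a category (base category), $T$ is an object of $\underline{\mathcal B}$ (base object), $\underline{\mathcal C}$ is a category (extended category), $J$ is a final object of $\underline{\mathcal C}$, and $R:\underline{\mathcal C}\to\underline{\mathcal B}$ is a functor with $R\,J=T$. Write $!_{C,J}:C\to J$ for the unique morphism. A morphism $g:B\to T$ in $\underline{\mathcal B}$ is definable by $\mathit{cr}$ if $g=R\,!_{C,J}$ for some object $C$ of $\underline{\mathcal C}$ with $R\,C=B$. For epi-corecursors $\mathit{cr},\mathit{cr}'$ with the same base category and base object, $\mathit{cr}'\geq\mathit{cr}$ means that every morphism $g:B\to T$ of $\underline{\mathcal B}$ (for every object $B$) that is definable by $\mathit{cr}$ is definable by $\mathit{cr}'$; $\mathit{cr}\equiv\mathit{cr}'$ means $\mathit{cr}\geq\mathit{cr}'$ and $\mathit{cr}'\geq\mathit{cr}$. **Infinitary terms (iterms).** $\mathsf{Var}$ is a set of variables of cardinality $\aleph_1$.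 $\mathsf{Perm}$ is the set of bijections $\sigma:\mathsf{Var}\to\mathsf{Var}$ with $\mathsf{supp}\,\sigma=\{x\mid\sigma\,x\neq x\}$ finite; $x\leftrightarrow y$ is the transposition; for variables, $x[\sigma]=\sigma\,x$, $x[z_1\wedge z_2]=(z_1\leftrightarrow z_2)(x)$, and $x[y/z]$ is $y$ if $x=z$ and $x$ otherwise. Pre-iterms are the possibly infinite trees given by the grammar $p::=\mathsf{PVr}\,x\mid\mathsf{PAp}\,p_1\,p_2\mid\mathsf{PLm}\,x\,p$ interpreted coinductively (the final coalgebra of the set functor $A\mapsto\mathsf{Var}+A\times A+\mathsf{Var}\times A$). On pre-iterms, swapping $p[z_1\wedge z_2]$ and permutation $p[\sigma]$ are defined corecursively by applying the swap/permutation to every variable, including binding ones. Freshness $z\,\#\,p$ is the largest relation such that $z\,\#\,p$ implies: $p=\mathsf{PVr}\,x$ with $z\neq x$; or $p=\mathsf{PAp}\,p_1\,p_2$ with $z\,\#\,p_1$ and $z\,\#\,p_2$; or $p=\mathsf{PLm}\,x\,p'$ with $z=x$ or $z\,\#\,p'$. $\alpha$-equivalence $\equiv$ is the largest relation such that $p\equiv q$ implies: $p=\mathsf{PVr}\,x=q$ for some $x$; or $p=\mathsf{PAp}\,p_1\,p_2$, $q=\mathsf{PAp}\,q_1\,q_2$ with $p_1\equiv q_1$, $p_2\equiv q_2$; or $p=\mathsf{PLm}\,x\,p'$, $q=\mathsf{PLm}\,y\,q'$ and for some $z$, ($z=x$ or $z\,\#\,p'$), ($z=y$ or $z\,\#\,q'$)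 and $p'[z\wedge x]\equiv q'[z\wedge y]$. It is an equivalence compatible with the constructors, swapping, permutation and freshness. The set of iterms is $\mathsf{Tr}_\infty=$ pre-iterms$/\equiv$, with the induced constructors $\mathsf{Vr},\mathsf{Ap},\mathsf{Lm}$, swapping, permutation and freshness; $\mathsf{FV}\,t=\{x\mid\neg\,x\,\#\,t\}$. Capture-avoiding substitution $t[s/z]$ is the unique operator with $(\mathsf{Vr}\,x)[s/z]=$ (if $x=z$ then $s$ else $\mathsf{Vr}\,x$), $(\mathsf{Ap}\,t_1\,t_2)[s/z]=\mathsf{Ap}(t_1[s/z])(t_2[s/z])$, and $(\mathsf{Lm}\,x\,t)[s/z]=\mathsf{Lm}\,x(t[s/z])$ if $x\neq z$ and $x\,\#\,s$; renaming is $t[y/z]=t[(\mathsf{Vr}\,y)/z]$. $\mathcal P_{\neq\emptyset}(A)$ is the set of nonempty subsets of $A$. For any set $M$, $\mathsf V,\mathsf A,\mathsf L$ denote the three injections into $\mathsf{Var}+M\times M+\mathcal P_{\neq\emptyset}(\mathsf{Var}\times M)$. The iterm destructor $\mathsf{Dest}:\mathsf{Tr}_\infty\to\mathsf{Var}+\mathsf{Tr}_\infty\times\mathsf{Tr}_\infty+\mathcal P_{\neq\emptyset}(\mathsf{Var}\times\mathsf{Tr}_\infty)$ is: $\mathsf{Dest}(\mathsf{Vr}\,x)=\mathsf V\,x$; $\mathsf{Dest}(\mathsf{Ap}\,t_1\,t_2)=\mathsf A(t_1,t_2)$; and $\mathsf{Dest}\,t=\mathsf L\{(x,t')\mid t=\mathsf{Lm}\,x\,t'\}$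 if $t$ is a $\mathsf{Lm}$-abstraction. **Signatures and models.** Symbols: $\mathsf{dest},\mathsf{vr},\mathsf{pm},\mathsf{sw},\mathsf{sb},\mathsf{ren},\mathsf{fv},\mathsf{fr}$. $\Sigma_{\mathsf{dtor}}=\{\mathsf{dest}\}$; all signatures considered extend it. A $\Sigma$-model $\mathcal M$ has a carrier set $M$, an operation $\mathsf{Dest}^{\mathcal M}:M\to\mathsf{Var}+M\times M+\mathcal P_{\neq\emptyset}(\mathsf{Var}\times M)$, and for the other symbols in $\Sigma$: $\mathsf{vr}$: $\mathsf{Vr}^{\mathcal M}:\mathsf{Var}\to M$; $\mathsf{pm}$: $\_[\_]^{\mathcal M}:M\to\mathsf{Perm}\to M$; $\mathsf{sw}$: $\_[\_\wedge\_]^{\mathcal M}:M\to\mathsf{Var}\to\mathsf{Var}\to M$; $\mathsf{sb}$: $\_[\_/\_]^{\mathcal M}:M\to M\to\mathsf{Var}\to M$; $\mathsf{ren}$: $\_[\_/\_]^{\mathcal M}:M\to\mathsf{Var}\to\mathsf{Var}\to M$; $\mathsf{fv}$: $\mathsf{FV}^{\mathcal M}:M\to\mathcal P(\mathsf{Var})$; $\mathsf{fr}$: $\#^{\mathcal M}:\mathsf{Var}\to M\to\mathsf{Bool}$. A morphism $g:\mathcal M\to\mathcal M'$ is a function $g:M\to M'$ that commutes with the operations for $\mathsf{vr},\mathsf{pm},\mathsf{sw},\mathsf{sb},\mathsf{ren}$ in $\Sigma$, satisfies ($x\,\#^{\mathcal M}m$ implies $x\,\#^{\mathcal M'}g\,m$)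 if $\mathsf{fr}\in\Sigma$ and $\mathsf{FV}^{\mathcal M'}(g\,m)\subseteq\mathsf{FV}^{\mathcal M}m$ if $\mathsf{fv}\in\Sigma$, and sub-commutes with the destructor: for all $m\in M$, if $\mathsf{Dest}^{\mathcal M}m=\mathsf V\,x$ then $\mathsf{Dest}^{\mathcal M'}(g\,m)=\mathsf V\,x$; if $\mathsf{Dest}^{\mathcal M}m=\mathsf A(m_1,m_2)$ then $\mathsf{Dest}^{\mathcal M'}(g\,m)=\mathsf A(g\,m_1,g\,m_2)$; if $\mathsf{Dest}^{\mathcal M}m=\mathsf L\,K$ then $\mathsf{Dest}^{\mathcal M'}(g\,m)=\mathsf L\,K'$ for some $K'\supseteq\{(x,g\,m')\mid(x,m')\in K\}$. $\mathcal{T}r_\infty(\Sigma)$ is the $\Sigma$-model with carrier $\mathsf{Tr}_\infty$ and the standard operators on iterms. **Properties** (interpreted in a model, superscripts omitted; $t,t',t_1,t_2,s,u$ range over the carrier $M$; $x,x',x_i,y,y_i,z,z_i$ over $\mathsf{Var}$; $\sigma,\tau$ over $\mathsf{Perm}$; all universally quantified unless said otherwise; ''countable'' means at most countable). Swapping: SwVr$_\infty$: if $\mathsf{Dest}\,t=\mathsf V\,x$ then $\mathsf{Dest}(t[z_1\wedge z_2])=\mathsf V(x[z_1\wedge z_2])$. SwAp$_\infty$: if $\mathsf{Dest}\,t=\mathsf A(t_1,t_2)$ then $\mathsf{Dest}(t[z_1\wedge z_2])=\mathsf A(t_1[z_1\wedge z_2],t_2[z_1\wedge z_2])$. SwLm$_\infty$: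 if $\mathsf{Dest}\,t=\mathsf L\,K$ then there is $K'$ with $\mathsf{Dest}(t[z_1\wedge z_2])=\mathsf L\,K'$ and $(x[z_1\wedge z_2],t'[z_1\wedge z_2])\in K'$ for all $(x,t')\in K$. SwId: $t[z\wedge z]=t$. SwIv: $t[x\wedge y][x\wedge y]=t$. SwCp: $t[x\wedge y][z_1\wedge z_2]=(t[z_1\wedge z_2])[(x[z_1\wedge z_2])\wedge(y[z_1\wedge z_2])]$. SwFr: if $x\,\#\,t$ and $y\,\#\,t$ then $t[x\wedge y]=t$. FrSw: $z\,\#\,t[x\wedge y]$ iff $z[x\wedge y]\,\#\,t$. SwCg$_\infty$: if $\mathsf{Dest}\,t=\mathsf L\,K$ and $\{(x_1,t_1),(x_2,t_2)\}\subseteq K$ then there is $z$ with ($z=x_1$ or $z\,\#\,t_1$), ($z=x_2$ or $z\,\#\,t_2$) and $t_1[z\wedge x_1]=t_2[z\wedge x_2]$. SwBvr$_\infty$: if $\mathsf{Dest}\,s=\mathsf L\,K$ and $\{(x,t),(x',t')\}\subseteq K$ then ($x'=x$ or $x'\,\#\,t$) and $t'=t[x'\wedge x]$. SwBvr$_{\infty,2}$: same as SwBvr$_\infty$ but with $x'\notin\mathsf{FV}\,t$ instead of $x'\,\#\,t$. Permutation: PmVr$_\infty$: if $\mathsf{Dest}\,t=\mathsf V\,x$ then $\mathsf{Dest}(t[\sigma])=\mathsf V(x[\sigma])$. PmAp$_\infty$: if $\mathsf{Dest}\,t=\mathsf A(t_1,t_2)$ then $\mathsf{Dest}(t[\sigma])=\mathsf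 A(t_1[\sigma],t_2[\sigma])$. PmLm$_\infty$: if $\mathsf{Dest}\,t=\mathsf L\,K$ then there is $K'$ with $\mathsf{Dest}(t[\sigma])=\mathsf L\,K'$ and $(x[\sigma],t'[\sigma])\in K'$ for all $(x,t')\in K$. PmId: $t[\mathsf{id}]=t$. PmCp: $t[\sigma][\tau]=t[\tau\circ\sigma]$. PmFv: if $\mathsf{supp}\,\sigma\cap\mathsf{FV}\,t=\emptyset$ then $t[\sigma]=t$. PmBvr$_\infty$: if $\mathsf{Dest}\,s=\mathsf L\,K$ and $\{(x,t),(x',t')\}\subseteq K$ then ($x'=x$ or $x'\notin\mathsf{FV}\,t$) and $t'=t[x'\leftrightarrow x]$. Substitution: SbVr$_\infty$: if $\mathsf{Dest}\,t=\mathsf V\,x$ then $\mathsf{Dest}(t[s/z])=$ (if $x=z$ then $\mathsf{Dest}\,s$ else $\mathsf V\,x$). SbAp$_\infty$: if $\mathsf{Dest}\,t=\mathsf A(t_1,t_2)$ then $\mathsf{Dest}(t[s/z])=\mathsf A(t_1[s/z],t_2[s/z])$. SbLm$_\infty$: if $\mathsf{Dest}\,t=\mathsf L\,K$ then there is $K'$ with $\mathsf{Dest}(t[s/z])=\mathsf L\,K'$ and $(x,t'[s/z])\in K'$ for all $(x,t')\in K$ with $x\neq z$ and $x\,\#\,s$. SbId: $t[(\mathsf{Vr}\,z)/z]=t$. SbChFr: if $x_2\,\#\,t$ then $t[(\mathsf{Vr}\,x_2)/x_1][s/x_2]=t[s/x_1]$. SbCm: if $x\neq y$, $y\,\#\,s$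 and $x\,\#\,u$ then $t[s/x][u/y]=t[u/y][s/x]$. SbFr: if $y\,\#\,t$ then $t[s/y]=t$. FrSb: $z\,\#\,t[s/y]$ iff ($z=y$ or $z\,\#\,t$) and ($y\,\#\,t$ or $z\,\#\,s$). SbBvr$_\infty$: if $\mathsf{Dest}\,s=\mathsf L\,K$ and $\{(x,t),(x',t')\}\subseteq K$ then ($x'=x$ or $x'\,\#\,t$) and $t'=t[(\mathsf{Vr}\,x')/x]$. SbBvr$'_\infty$: if $\mathsf{Dest}\,s=\mathsf L\,K$, $(x,t)\in K$ and $x'\,\#\,t$ then $(x',t[(\mathsf{Vr}\,x')/x])\in K$. VrInv: $\mathsf{Dest}\,t=\mathsf V\,x$ iff $t=\mathsf{Vr}\,x$. FrVr: if $z\neq x$ then $z\,\#\,\mathsf{Vr}\,x$. Renaming: RnVr$_\infty$: if $\mathsf{Dest}\,t=\mathsf V\,x$ then $\mathsf{Dest}(t[y/z])=\mathsf V(x[y/z])$. RnAp$_\infty$: if $\mathsf{Dest}\,t=\mathsf A(t_1,t_2)$ then $\mathsf{Dest}(t[y/z])=\mathsf A(t_1[y/z],t_2[y/z])$. RnLm$_{1,\infty}$: if $\mathsf{Dest}\,t=\mathsf L\,K$ then there is $K'$ with $\mathsf{Dest}(t[y/z])=\mathsf L\,K'$ and $(x,t'[y/z])\in K'$ for all $(x,t')\in K$ with $x\notin\{y,z\}$. RnId: $t[z/z]=t$. RnIm: if $x_1\neq y$ then $t[x_1/y][x_2/y]=t[x_1/y]$. RnCh: if $y\neq x_2$ then $t[y/x_2][x_2/x_1][x_3/x_2]=t[y/x_2][x_3/x_1]$.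 RnCm: if $x_2\neq y_1\neq x_1\neq y_2$ then $t[x_2/x_1][y_2/y_1]=t[y_2/y_1][x_2/x_1]$. RnChFr: if $x_2\,\#\,t$ then $t[x_2/x_1][x_3/x_2]=t[x_3/x_1]$. RnFr: if $y\,\#\,t$ then $t[x/y]=t$. FrRn: $z\,\#\,t[x/y]$ iff ($z=y$ or $z\,\#\,t$) and ($y\,\#\,t$ or $x\neq z$). FrRn$_2$: $z[x/y]\,\#\,t[x/y]$ implies $z\,\#\,t$. RnBvr$_\infty$: if $\mathsf{Dest}\,s=\mathsf L\,K$ and $\{(x,t),(x',t')\}\subseteq K$ then ($x'=x$ or $x'\,\#\,t$) and $t'=t[x'/x]$. RnBvr$'_\infty$: if $\mathsf{Dest}\,s=\mathsf L\,K$, $(x,t)\in K$ and $x'\,\#\,t$ then $(x',t[x'/x])\in K$. Freshness/freeness: FrVr$_\infty$: if $\mathsf{Dest}\,t=\mathsf V\,x$ and $z\,\#\,t$ then $z\neq x$. FrAp$_\infty$: if $\mathsf{Dest}\,t=\mathsf A(t_1,t_2)$ and $z\,\#\,t$ then $z\,\#\,t_1$ and $z\,\#\,t_2$. FrLm$_\infty$: if $\mathsf{Dest}\,t=\mathsf L\,K$, $(x,t')\in K$ and $z\,\#\,t$ then $z=x$ or $z\,\#\,t'$. FvVr$_\infty$: if $\mathsf{Dest}\,t=\mathsf V\,x$ then $x\in\mathsf{FV}\,t$. FvAp$_\infty$: if $\mathsf{Dest}\,t=\mathsf A(t_1,t_2)$ then $\mathsf{FV}\,t_1\cup\mathsf{FV}\,t_2\subseteq\mathsf{FV}\,t$.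 FvLm$_\infty$: if $\mathsf{Dest}\,t=\mathsf L\,K$ and $(x,t')\in K$ then $\mathsf{FV}\,t'\setminus\{x\}\subseteq\mathsf{FV}\,t$. FvDPm$_\infty$: $\mathsf{FV}\,t=\{x\mid\{y\mid t[x\leftrightarrow y]\neq t\}\text{ is uncountable}\}$. FvDSw$_\infty$: $\mathsf{FV}\,t=\{x\mid\{y\mid t[x\wedge y]\neq t\}\text{ is uncountable}\}$. FSupFr$_\infty$: $\{x\mid\neg\,x\,\#\,t\}$ is countable. FrDRn$_\infty$: $x\,\#\,t$ iff $\{y\mid t[y/x]\neq t\}$ is countable. A $(\Sigma,\mathsf{Props})$-model is a $\Sigma$-model satisfying all properties in $\mathsf{Props}$. **The sets $\mathsf{Props}_i$.** $\mathsf{Props}_1$ (perm/free): PmVr$_\infty$, PmAp$_\infty$, PmLm$_\infty$, PmId, PmCp, FvDPm$_\infty$, PmBvr$_\infty$. $\mathsf{Props}_2$ (perm/free variant): PmVr$_\infty$, PmAp$_\infty$, PmLm$_\infty$, PmId, PmCp, PmFv, PmBvr$_\infty$, FvVr$_\infty$, FvAp$_\infty$, FvLm$_\infty$. $\mathsf{Props}_3$ (swap/free variant): SwVr$_\infty$, SwAp$_\infty$, SwLm$_\infty$, SwId, SwIv, SwCp, FvDSw$_\infty$, SwBvr$_{\infty,2}$. $\mathsf{Props}_5$ (swap/fresh variant): SwVr$_\infty$, SwAp$_\infty$, SwLm$_\infty$, SwId, SwIv, SwCp, SwFr, SwBvr$_\infty$, FrVr$_\infty$, FrAp$_\infty$,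 FrLm$_\infty$. $\mathsf{Props}_6$ (swap/fresh): SwVr$_\infty$, SwAp$_\infty$, SwLm$_\infty$, SwId, SwIv, SwCp, SwFr, FrSw, SwCg$_\infty$, FrVr$_\infty$, FrAp$_\infty$, FrLm$_\infty$. $\mathsf{Props}_7$ (subst/fresh): SbVr$_\infty$, SbAp$_\infty$, SbLm$_\infty$, SbId, SbChFr, SbCm, SbFr, FrSb, SbBvr$_\infty$, SbBvr$'_\infty$, FSupFr$_\infty$, FrVr$_\infty$, FrAp$_\infty$, FrLm$_\infty$, VrInv, FrVr. $\mathsf{Props}_8$ (renaming): RnVr$_\infty$, RnAp$_\infty$, RnLm$_{1,\infty}$, RnId, RnIm, RnCh, RnCm, FrDRn$_\infty$, RnBvr$_\infty$, RnBvr$'_\infty$, FSupFr$_\infty$, FrRn$_2$. $\mathsf{Props}_9$ (renaming/fresh variant): RnVr$_\infty$, RnAp$_\infty$, RnLm$_{1,\infty}$, RnId, RnChFr, RnCm, RnFr, FrRn, RnBvr$_\infty$, RnBvr$'_\infty$, FSupFr$_\infty$, FrVr$_\infty$, FrAp$_\infty$, FrLm$_\infty$. **The epi-corecursors.** For $i\in\{1,2,3,5,6,7,8,9\}$, $\mathit{cr}_i=(\underline{\mathcal B},T,\underline{\mathcal C}_i,J_i,R_i)$, where $\Sigma_i$ consists of the symbols occurring in $\mathsf{Props}_i$, $\underline{\mathcal B}$ is the category of $\Sigma_{\mathsf{dtor}}$-models, $T=\mathcal{T}r_\infty(\Sigma_{\mathsf{dtor}})$, $\underline{\mathcal C}_i$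 is the category of $(\Sigma_i,\mathsf{Props}_i)$-models and $\Sigma_i$-model morphisms, $J_i=\mathcal{T}r_\infty(\Sigma_i)$ (which is final in $\underline{\mathcal C}_i$), and $R_i:\underline{\mathcal C}_i\to\underline{\mathcal B}$ is the forgetful functor to underlying $\Sigma_{\mathsf{dtor}}$-models. *)

(* Defs.v *)
From HB Require Import structures.
From mathcomp Require Import all_boot.
From mathcomp Require Import mathcomp_extra boolp classical_sets functions.
From mathcomp Require Import cardinality wochoice.

Set Implicit Arguments.
Unset Strict Implicit.
Unset Printing Implicit Defensive.

Local Open Scope classical_set_scope.

Record category := Category {
  obj :> Type;
  hom : obj -> obj -> Type;
  idm : forall a, hom a a;
  compm : forall a b c, hom b c -> hom a b -> hom a c;
  compm1 : forall a b (f : hom a b), compm f (idm a) = f;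
  comp1m : forall a b (f : hom a b), compm (idm b) f = f;
  compmA : forall a b c d (h : hom c d) (g : hom b c) (f : hom a b),
    compm h (compm g f) = compm (compm h g) f }.

Record functor (C D : category) := Functor {
  fobj :> C -> D;
  fmap : forall a b, hom a b -> hom (fobj a) (fobj b);
  fmap1 : forall a, fmap (idm a) = idm (fobj a);
  fmapM : forall a b c (g : hom b c) (f : hom a b),
    fmap (compm g f) = compm (fmap g) (fmap f) }.

Definition final_object (C : category) (J : C) : Prop :=
  forall c : C, exists h : hom c J, forall k : hom c J, k = h.

(* The base category and the base object are parameters of the type, because
   strength is only compared between epi-corecursors which share them. *)
Record epi_corecursor (B : category) (T : B) := EpiCorecursor {
  ext : category;
  ext_final : ext;
  ext_finalP : final_object ext_final;
  ext_forget : functor ext B;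
  ext_forget_final : ext_forget ext_final = T }.

Section Strength.
Variables (B : category) (T : B).
Implicit Type cr : epi_corecursor T.

Definition bang cr (c : ext cr) : hom c (ext_final cr) :=
  sval (cid (ext_finalP c)).

Definition cast_hom (a a' b b' : B) (ea : a = a') (eb : b = b')
    (f : hom a b) : hom a' b' :=
  match ea in _ = x, eb in _ = y return hom x y with
  | erefl, erefl => f
  end.

Definition definable cr (b : B) (g : hom b T) : Prop :=
  exists (c : ext cr) (e : ext_forget cr c = b),
    g = cast_hom e (ext_forget_final cr) (fmap (ext_forget cr) (bang c)).

Definition at_least_as_strong cr' cr : Prop :=
  forall (b : B) (g : hom b T), definable cr g -> definable cr' g.

Definition equally_strong cr cr' : Prop :=
  at_least_as_strong cr cr' /\ at_least_as_strong cr' cr.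

End Strength.

(* Equipotence with omega_1: uncountable, with a well-order all of whose
   initial segments are countable. *)
Definition has_card_aleph1 (T : eqType) : Prop :=
  ~ countable [set: T] /\
  exists R : rel T, well_order R /\ forall x, countable [set y | R y x].

Section Iterms.
Variable Var : eqType.

Definition swapv (z1 z2 x : Var) : Var :=
  if x == z1 then z2 else if x == z2 then z1 else x.

Definition renv (y z x : Var) : Var := if x == z then y else x.

Record perm := Perm {
  perm_fun :> Var -> Var;
  perm_bij : bijective perm_fun;
  perm_fin : finite_set [set x | perm_fun x <> x] }.

Definition supp (s : perm) : set Var := [set x | s x <> x].

Lemma swapvK z1 z2 : involutive (swapv z1 z2).
Proof.
move=> x; rewrite /swapv.
have [->|n1] := eqVneq x z1.
  by rewrite eqxx; case: eqVneq.
have [->|n2] := eqVneq x z2; first by rewrite eqxx.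
by rewrite (negPf n1) (negPf n2).
Qed.

Lemma swapv_supp z1 z2 : finite_set [set x | swapv z1 z2 x <> x].
Proof.
apply: (@sub_finite_set _ _ [set z1; z2]); last exact: finite_set2.
move=> x /=; rewrite /swapv.
have [->|_] := eqVneq x z1; first by left.
by have [->|_] := eqVneq x z2; first by right.
Qed.

Lemma comp_supp (t s : perm) : finite_set [set x | (t \o s) x <> x].
Proof.
apply: (@sub_finite_set _ _ (supp t `|` supp s)).
  move=> x /= nx; have [e|ne] := eqVneq (s x) x.
    by left; move: nx; rewrite /= e.
  by right; apply/eqP.
by rewrite finite_setU; split; [exact: perm_fin t|exact: perm_fin s].
Qed.

Lemma id_supp : finite_set [set x : Var | id x <> x].
Proof.
by apply: (@sub_finite_set _ _ set0) => [x|]; [case|exact: finite_set0].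
Qed.

Definition perm_id : perm := Perm (inv_bij (fun x : Var => erefl x)) id_supp.

Definition perm_comp (t s : perm) : perm :=
  Perm (bij_comp (perm_bij t) (perm_bij s)) (comp_supp t s).

Definition transp (x y : Var) : perm :=
  Perm (inv_bij (swapvK x y)) (swapv_supp x y).

(* Leibniz equality of coinductive trees is finer than bisimilarity, hence than
   equality in the final coalgebra. This is harmless: only the quotient by
   [alpha] is used, and [alpha] identifies bisimilar trees. *)
CoInductive preiterm : Type :=
| PVr of Var
| PAp of preiterm & preiterm
| PLm of Var & preiterm.

CoFixpoint pre_map (f : Var -> Var) (p : preiterm) : preiterm :=
  match p with
  | PVr x => PVr (f x)
  | PAp p1 p2 => PAp (pre_map f p1) (pre_map f p2)
  | PLm x p' => PLm (f x) (pre_map f p')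
  end.

Definition pswap (p : preiterm) (z1 z2 : Var) : preiterm :=
  pre_map (swapv z1 z2) p.

Definition pperm (p : preiterm) (s : perm) : preiterm := pre_map s p.

CoInductive pfresh (z : Var) : preiterm -> Prop :=
| PFreshVr x : z <> x -> pfresh z (PVr x)
| PFreshAp p1 p2 : pfresh z p1 -> pfresh z p2 -> pfresh z (PAp p1 p2)
| PFreshLm x p : z = x \/ pfresh z p -> pfresh z (PLm x p).

CoInductive alpha : preiterm -> preiterm -> Prop :=
| AlphaVr x : alpha (PVr x) (PVr x)
| AlphaAp p1 p2 q1 q2 :
    alpha p1 q1 -> alpha p2 q2 -> alpha (PAp p1 p2) (PAp q1 q2)
| AlphaLm x y p q z :
    z = x \/ pfresh z p -> z = y \/ pfresh z q ->
    alpha (pswap p z x) (pswap q z y) -> alpha (PLm x p) (PLm y q).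

(* The quotient is the type of equivalence classes; operations are lifted
   through chosen representatives, as [alpha] is compatible with them when [Var]
   has cardinality aleph_1. *)
Definition iterm : Type :=
  {A : set preiterm | exists p, A = [set q | alpha p q]}.

Definition iclass (p : preiterm) : iterm :=
  exist _ [set q | alpha p q] (ex_intro _ p erefl).

Definition irepr (t : iterm) : preiterm := sval (cid (svalP t)).

Definition iVr (x : Var) : iterm := iclass (PVr x).
Definition iAp (t1 t2 : iterm) : iterm := iclass (PAp (irepr t1) (irepr t2)).
Definition iLm (x : Var) (t : iterm) : iterm := iclass (PLm x (irepr t)).

Definition iswap (t : iterm) (z1 z2 : Var) : iterm :=
  iclass (pswap (irepr t) z1 z2).
Definition iperm (t : iterm) (s : perm) : iterm := iclass (pperm (irepr t) s).
Definition ifresh (z : Var) (t : iterm) : Prop := pfresh z (irepr t).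
Definition iFV (t : iterm) : set Var := [set x | ~ ifresh x t].

Definition is_subst (f : iterm -> iterm -> Var -> iterm) : Prop :=
  [/\ forall x s z, f (iVr x) s z = if x == z then s else iVr x,
      forall t1 t2 s z, f (iAp t1 t2) s z = iAp (f t1 s z) (f t2 s z)
    & forall x t s z, x <> z -> ifresh x s ->
        f (iLm x t) s z = iLm x (f t s z)].

(* [isubst t s z] is t[s/z], the unique operator satisfying [is_subst];
   the second branch is never taken when [Var] has cardinality aleph_1. *)
Definition isubst : iterm -> iterm -> Var -> iterm :=
  match pselect (exists f, is_subst f) with
  | left h => sval (cid h)
  | right _ => fun t _ _ => t
  end.

Definition irename (t : iterm) (y z : Var) : iterm := isubst t (iVr y) z.

(* Var + M * M + P_{<> empty}(Var * M) *)
Inductive shape (M : Type) : Type :=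
| V of Var
| A of M & M
| L of {K : set (Var * M) | K !=set0}.

Lemma lm_set_neq0 (t : iterm) (h : exists p : Var * iterm, t = iLm p.1 p.2) :
  [set p : Var * iterm | t = iLm p.1 p.2] !=set0.
Proof. exact: h. Qed.

(* Every iterm has exactly one of the three forms, and iVr, iAp are injective;
   the value in the last branch is irrelevant. *)
Definition idest (t : iterm) : shape iterm :=
  match pselect (exists x, t = iVr x) with
  | left h => V iterm (sval (cid h))
  | right _ =>
    match pselect (exists p : iterm * iterm, t = iAp p.1 p.2) with
    | left h => A (sval (cid h)).1 (sval (cid h)).2
    | right _ =>
      match pselect (exists p : Var * iterm, t = iLm p.1 p.2) with
      | left h => L (exist _ _ (lm_set_neq0 h))
      | right _ => A t t
      end
    end
  end.

Inductive symbol :=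
| s_dest | s_vr | s_pm | s_sw | s_sb | s_ren | s_fv | s_fr.

Definition signature := symbol -> bool.

(* Argument orders: [pm m s] is m[s]; [sw m z1 z2] is m[z1 /\ z2];
   [sb m n z] is m[n/z]; [ren m y z] is m[y/z]; [fr z m] is z # m. Truth values
   are classical propositions. *)
Definition interp (s : symbol) (M : Type) : Type :=
  match s with
  | s_dest => M -> shape M
  | s_vr => Var -> M
  | s_pm => M -> perm -> M
  | s_sw => M -> Var -> Var -> M
  | s_sb => M -> M -> Var -> M
  | s_ren => M -> Var -> Var -> M
  | s_fv => M -> set Var
  | s_fr => Var -> M -> Prop
  end.

Record model (S : signature) := Model {
  carrier :> Type;
  op : forall s, S s -> interp s carrier }.

Definition preserves (M M' : Type) (g : M -> M') (s : symbol) :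
    interp s M -> interp s M' -> Prop :=
  match s return interp s M -> interp s M' -> Prop with
  | s_dest => fun d d' => forall m,
      match d m with
      | V x => d' (g m) = V M' x
      | A m1 m2 => d' (g m) = A (g m1) (g m2)
      | L K => exists K', d' (g m) = L K' /\
          forall x m', sval K (x, m') -> sval K' (x, g m')
      end
  | s_vr => fun v v' => forall x, g (v x) = v' x
  | s_pm => fun p p' => forall m s, g (p m s) = p' (g m) s
  | s_sw => fun w w' => forall m z1 z2, g (w m z1 z2) = w' (g m) z1 z2
  | s_sb => fun b b' => forall m n z, g (b m n z) = b' (g m) (g n) z
  | s_ren => fun r r' => forall m y z, g (r m y z) = r' (g m) y z
  | s_fv => fun F F' => forall m, F' (g m) `<=` F m
  | s_fr => fun f f' => forall x m, f x m -> f' x (g m)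
  end.

Definition is_morphism (S : signature) (M M' : model S) (g : M -> M') : Prop :=
  forall s (hs : S s), preserves g (op M hs) (op M' hs).

Lemma preserves_id (M : Type) s (o : interp s M) : preserves id o o.
Proof.
case: s o => //= d m; first by case: (d m) => // K; exists K.
by move=> x.
Qed.

Lemma preserves_comp (M M' M'' : Type) (g : M -> M') (g' : M' -> M'') s
    (o : interp s M) (o' : interp s M') (o'' : interp s M'') :
  preserves g o o' -> preserves g' o' o'' -> preserves (g' \o g) o o''.
Proof.
case: s o o' o'' => /= o o' o'' H H'.
- move=> m; move: (H m) (H' (g m)); case: (o m) => [x|m1 m2|K] /=.
  + by move=> ->.
  + by move=> ->.
  + move=> [K' [-> HK]] [K'' [-> HK']]; exists K''; split=> // x m' xm'.
    by apply: HK'; apply: HK.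
- by move=> x; rewrite H H'.
- by move=> m s; rewrite H H'.
- by move=> m z1 z2; rewrite H H'.
- by move=> m n z; rewrite H H'.
- by move=> m y z; rewrite H H'.
- by move=> m x /H'; apply: H.
- by move=> x m /H; apply: H'.
Qed.

Section ModelCategory.
Variables (S : signature) (P : model S -> Prop).

Definition mod_obj : Type := {M : model S | P M}.

Definition mod_hom (M M' : mod_obj) : Type :=
  {g : sval M -> sval M' | is_morphism g}.

Lemma mod_homP (M M' : mod_obj) (g h : mod_hom M M') :
  sval g = sval h -> g = h.
Proof. by case: g h => [g Hg] [h Hh] /= e; apply: eq_exist. Qed.

Definition mod_id (M : mod_obj) : mod_hom M M :=
  exist (@is_morphism S (sval M) (sval M)) id
    (fun s hs => preserves_id (op (sval M) hs)).

Definition mod_comp (M M' M'' : mod_obj) (g' : mod_hom M' M'')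
    (g : mod_hom M M') : mod_hom M M'' :=
  exist (@is_morphism S (sval M) (sval M'')) (sval g' \o sval g)
    (fun s hs => preserves_comp (svalP g s hs) (svalP g' s hs)).

Definition mod_cat : category.
Proof.
by refine (@Category mod_obj mod_hom mod_id mod_comp _ _ _) => *; apply: mod_homP.
Defined.

End ModelCategory.

Definition std_op (s : symbol) : interp s iterm :=
  match s return interp s iterm with
  | s_dest => idest
  | s_vr => iVr
  | s_pm => iperm
  | s_sw => iswap
  | s_sb => isubst
  | s_ren => irename
  | s_fv => iFV
  | s_fr => ifresh
  end.

Definition Tr (S : signature) : model S :=
  @Model S iterm (fun s _ => std_op s).

Definition sig_dtor : signature :=
  fun s => match s with s_dest => true | _ => false end.

Definition base_cat : category := mod_cat (fun _ : model sig_dtor => True).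

Definition base_obj : base_cat := exist _ (Tr sig_dtor) I.

Section Forget.
Variables (S : signature) (hS : forall s, sig_dtor s -> S s).
Variable (P : model S -> Prop).

Definition reduct (M : model S) : model sig_dtor :=
  @Model sig_dtor M (fun s hs => op M (hS hs)).

Definition forget_obj (M : mod_cat P) : base_cat :=
  exist _ (reduct (sval M)) I.

Definition forget_hom (M M' : mod_cat P) (g : hom M M') :
    hom (forget_obj M) (forget_obj M') :=
  exist (@is_morphism _ (reduct (sval M)) (reduct (sval M')))
    (sval g) (fun s hs => svalP g s (hS hs)).

Definition forget : functor (mod_cat P) base_cat.
Proof.
by refine (@Functor _ _ forget_obj forget_hom _ _) => *; apply: mod_homP.
Defined.

End Forget.

Section Properties.
Variables (M : Type) (dest : M -> shape M) (vr : Var -> M).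
Variables (pm : M -> perm -> M) (sw : M -> Var -> Var -> M).
Variables (sb : M -> M -> Var -> M) (ren : M -> Var -> Var -> M).
Variables (fv : M -> set Var) (fr : Var -> M -> Prop).
Implicit Types (t s u : M) (x y z : Var).
Implicit Type K : {K : set (Var * M) | K !=set0}.

Definition SwVr := forall t x z1 z2,
  dest t = V M x -> dest (sw t z1 z2) = V M (swapv z1 z2 x).
Definition SwAp := forall t t1 t2 z1 z2,
  dest t = A t1 t2 -> dest (sw t z1 z2) = A (sw t1 z1 z2) (sw t2 z1 z2).
Definition SwLm := forall t K z1 z2, dest t = L K ->
  exists K', dest (sw t z1 z2) = L K' /\
    forall x t', sval K (x, t') -> sval K' (swapv z1 z2 x, sw t' z1 z2).
Definition SwId := forall t z, sw t z z = t.
Definition SwIv := forall t x y, sw (sw t x y) x y = t.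
Definition SwCp := forall t x y z1 z2,
  sw (sw t x y) z1 z2 = sw (sw t z1 z2) (swapv z1 z2 x) (swapv z1 z2 y).
Definition SwFr := forall t x y, fr x t -> fr y t -> sw t x y = t.
Definition FrSw := forall t x y z, fr z (sw t x y) <-> fr (swapv x y z) t.
Definition SwCg := forall t K x1 t1 x2 t2,
  dest t = L K -> sval K (x1, t1) -> sval K (x2, t2) ->
  exists z, [/\ z = x1 \/ fr z t1, z = x2 \/ fr z t2
              & sw t1 z x1 = sw t2 z x2].
Definition SwBvr := forall s K x t x' t',
  dest s = L K -> sval K (x, t) -> sval K (x', t') ->
  (x' = x \/ fr x' t) /\ t' = sw t x' x.
Definition SwBvr2 := forall s K x t x' t',
  dest s = L K -> sval K (x, t) -> sval K (x', t') ->
  (x' = x \/ ~ fv t x') /\ t' = sw t x' x.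

Definition PmVr := forall t x (r : perm),
  dest t = V M x -> dest (pm t r) = V M (r x).
Definition PmAp := forall t t1 t2 (r : perm),
  dest t = A t1 t2 -> dest (pm t r) = A (pm t1 r) (pm t2 r).
Definition PmLm := forall t K (r : perm), dest t = L K ->
  exists K', dest (pm t r) = L K' /\
    forall x t', sval K (x, t') -> sval K' (r x, pm t' r).
Definition PmId := forall t, pm t perm_id = t.
Definition PmCp := forall t (r q : perm), pm (pm t r) q = pm t (perm_comp q r).
Definition PmFv := forall t (r : perm),
  supp r `&` fv t = set0 -> pm t r = t.
Definition PmBvr := forall s K x t x' t',
  dest s = L K -> sval K (x, t) -> sval K (x', t') ->
  (x' = x \/ ~ fv t x') /\ t' = pm t (transp x' x).

Definition SbVr := forall t s x z, dest t = V M x ->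
  dest (sb t s z) = if x == z then dest s else V M x.
Definition SbAp := forall t t1 t2 s z,
  dest t = A t1 t2 -> dest (sb t s z) = A (sb t1 s z) (sb t2 s z).
Definition SbLm := forall t K s z, dest t = L K ->
  exists K', dest (sb t s z) = L K' /\
    forall x t', sval K (x, t') -> x <> z -> fr x s -> sval K' (x, sb t' s z).
Definition SbId := forall t z, sb t (vr z) z = t.
Definition SbChFr := forall t s x1 x2,
  fr x2 t -> sb (sb t (vr x2) x1) s x2 = sb t s x1.
Definition SbCm := forall t s u x y,
  x <> y -> fr y s -> fr x u -> sb (sb t s x) u y = sb (sb t u y) s x.
Definition SbFr := forall t s y, fr y t -> sb t s y = t.
Definition FrSb := forall t s y z,
  fr z (sb t s y) <-> (z = y \/ fr z t) /\ (fr y t \/ fr z s).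
Definition SbBvr := forall s K x t x' t',
  dest s = L K -> sval K (x, t) -> sval K (x', t') ->
  (x' = x \/ fr x' t) /\ t' = sb t (vr x') x.
Definition SbBvr' := forall s K x t x',
  dest s = L K -> sval K (x, t) -> fr x' t -> sval K (x', sb t (vr x') x).
Definition VrInv := forall t x, dest t = V M x <-> t = vr x.
Definition FrVr := forall x z, z <> x -> fr z (vr x).

Definition RnVr := forall t x y z,
  dest t = V M x -> dest (ren t y z) = V M (renv y z x).
Definition RnAp := forall t t1 t2 y z,
  dest t = A t1 t2 -> dest (ren t y z) = A (ren t1 y z) (ren t2 y z).
Definition RnLm1 := forall t K y z, dest t = L K ->
  exists K', dest (ren t y z) = L K' /\
    forall x t', sval K (x, t') -> x <> y -> x <> z -> sval K' (x, ren t' y z).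
Definition RnId := forall t z, ren t z z = t.
Definition RnIm := forall t x1 x2 y,
  x1 <> y -> ren (ren t x1 y) x2 y = ren t x1 y.
Definition RnCh := forall t y x1 x2 x3, y <> x2 ->
  ren (ren (ren t y x2) x2 x1) x3 x2 = ren (ren t y x2) x3 x1.
Definition RnCm := forall t x1 x2 y1 y2, x2 <> y1 -> y1 <> x1 -> x1 <> y2 ->
  ren (ren t x2 x1) y2 y1 = ren (ren t y2 y1) x2 x1.
Definition RnChFr := forall t x1 x2 x3,
  fr x2 t -> ren (ren t x2 x1) x3 x2 = ren t x3 x1.
Definition RnFr := forall t x y, fr y t -> ren t x y = t.
Definition FrRn := forall t x y z,
  fr z (ren t x y) <-> (z = y \/ fr z t) /\ (fr y t \/ x <> z).
Definition FrRn2 := forall t x y z, fr (renv x y z) (ren t x y) -> fr z t.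
Definition RnBvr := forall s K x t x' t',
  dest s = L K -> sval K (x, t) -> sval K (x', t') ->
  (x' = x \/ fr x' t) /\ t' = ren t x' x.
Definition RnBvr' := forall s K x t x',
  dest s = L K -> sval K (x, t) -> fr x' t -> sval K (x', ren t x' x).

(* The next three destruct a member of the model, unlike FrVr, which is about
   the operation vr. *)
Definition FrVrD := forall t x z, dest t = V M x -> fr z t -> z <> x.
Definition FrApD := forall t t1 t2 z,
  dest t = A t1 t2 -> fr z t -> fr z t1 /\ fr z t2.
Definition FrLmD := forall t K x t' z,
  dest t = L K -> sval K (x, t') -> fr z t -> z = x \/ fr z t'.
Definition FvVr := forall t x, dest t = V M x -> fv t x.
Definition FvAp := forall t t1 t2,
  dest t = A t1 t2 -> fv t1 `|` fv t2 `<=` fv t.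
Definition FvLm := forall t K x t',
  dest t = L K -> sval K (x, t') -> fv t' `\ x `<=` fv t.
Definition FvDPm := forall t,
  fv t = [set x | ~ countable [set y | pm t (transp x y) <> t]].
Definition FvDSw := forall t,
  fv t = [set x | ~ countable [set y | sw t x y <> t]].
Definition FSupFr := forall t, countable [set x | ~ fr x t].
Definition FrDRn := forall t x,
  fr x t <-> countable [set y | ren t y x <> t].

End Properties.

Inductive cr_index := i1 | i2 | i3 | i5 | i6 | i7 | i8 | i9.

(* The symbols occurring in the i-th set of properties. *)
Definition Sigma (i : cr_index) : signature :=
  match i with
  | i1 | i2 => fun s => match s with s_dest | s_pm | s_fv => true | _ => false end
  | i3 => fun s => match s with s_dest | s_sw | s_fv => true | _ => false end
  | i5 | i6 => fun s => match s with s_dest | s_sw | s_fr => true | _ => false end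
  | i7 => fun s =>
      match s with s_dest | s_vr | s_sb | s_fr => true | _ => false end
  | i8 | i9 => fun s => match s with s_dest | s_ren | s_fr => true | _ => false end
  end.

Definition Props1 (M : model (Sigma i1)) : Prop :=
  let dest := @op _ M s_dest isT in
  let pm := @op _ M s_pm isT in
  let fv := @op _ M s_fv isT in
  [/\ PmVr dest pm, PmAp dest pm & PmLm dest pm] /\
  [/\ PmId pm, PmCp pm, FvDPm pm fv & PmBvr dest pm fv].

Definition Props2 (M : model (Sigma i2)) : Prop :=
  let dest := @op _ M s_dest isT in
  let pm := @op _ M s_pm isT in
  let fv := @op _ M s_fv isT in
  [/\ PmVr dest pm, PmAp dest pm & PmLm dest pm] /\
  [/\ PmId pm, PmCp pm, PmFv pm fv & PmBvr dest pm fv] /\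
  [/\ FvVr dest fv, FvAp dest fv & FvLm dest fv].

Definition Props3 (M : model (Sigma i3)) : Prop :=
  let dest := @op _ M s_dest isT in
  let sw := @op _ M s_sw isT in
  let fv := @op _ M s_fv isT in
  [/\ SwVr dest sw, SwAp dest sw & SwLm dest sw] /\
  [/\ SwId sw, SwIv sw & SwCp sw] /\
  [/\ FvDSw sw fv & SwBvr2 dest sw fv].

Definition Props5 (M : model (Sigma i5)) : Prop :=
  let dest := @op _ M s_dest isT in
  let sw := @op _ M s_sw isT in
  let fr := @op _ M s_fr isT in
  [/\ SwVr dest sw, SwAp dest sw & SwLm dest sw] /\
  [/\ SwId sw, SwIv sw & SwCp sw] /\
  [/\ SwFr sw fr & SwBvr dest sw fr] /\
  [/\ FrVrD dest fr, FrApD dest fr & FrLmD dest fr].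

Definition Props6 (M : model (Sigma i6)) : Prop :=
  let dest := @op _ M s_dest isT in
  let sw := @op _ M s_sw isT in
  let fr := @op _ M s_fr isT in
  [/\ SwVr dest sw, SwAp dest sw & SwLm dest sw] /\
  [/\ SwId sw, SwIv sw & SwCp sw] /\
  [/\ SwFr sw fr, FrSw sw fr & SwCg dest sw fr] /\
  [/\ FrVrD dest fr, FrApD dest fr & FrLmD dest fr].

Definition Props7 (M : model (Sigma i7)) : Prop :=
  let dest := @op _ M s_dest isT in
  let vr := @op _ M s_vr isT in
  let sb := @op _ M s_sb isT in
  let fr := @op _ M s_fr isT in
  [/\ SbVr dest sb, SbAp dest sb & SbLm dest sb fr] /\
  [/\ SbId vr sb, SbChFr vr sb fr, SbCm sb fr, SbFr sb fr & FrSb sb fr] /\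
  [/\ SbBvr dest vr sb fr & SbBvr' dest vr sb fr] /\
  [/\ FSupFr fr, FrVrD dest fr, FrApD dest fr & FrLmD dest fr] /\
  [/\ VrInv dest vr & FrVr vr fr].

Definition Props8 (M : model (Sigma i8)) : Prop :=
  let dest := @op _ M s_dest isT in
  let ren := @op _ M s_ren isT in
  let fr := @op _ M s_fr isT in
  [/\ RnVr dest ren, RnAp dest ren & RnLm1 dest ren] /\
  [/\ RnId ren, RnIm ren, RnCh ren & RnCm ren] /\
  [/\ FrDRn ren fr, RnBvr dest ren fr & RnBvr' dest ren fr] /\
  [/\ FSupFr fr & FrRn2 ren fr].

Definition Props9 (M : model (Sigma i9)) : Prop :=
  let dest := @op _ M s_dest isT in
  let ren := @op _ M s_ren isT in
  let fr := @op _ M s_fr isT in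
  [/\ RnVr dest ren, RnAp dest ren & RnLm1 dest ren] /\
  [/\ RnId ren, RnChFr ren fr, RnCm ren, RnFr ren fr & FrRn ren fr] /\
  [/\ RnBvr dest ren fr & RnBvr' dest ren fr] /\
  [/\ FSupFr fr, FrVrD dest fr, FrApD dest fr & FrLmD dest fr].

Definition Props (i : cr_index) : model (Sigma i) -> Prop :=
  match i return model (Sigma i) -> Prop with
  | i1 => Props1
  | i2 => Props2
  | i3 => Props3
  | i5 => Props5
  | i6 => Props6
  | i7 => Props7
  | i8 => Props8
  | i9 => Props9
  end.

Lemma sig_dtor_Sigma (i : cr_index) s : sig_dtor s -> Sigma i s.
Proof. by case: s => // _; case: i. Qed.

Definition ext_cat (i : cr_index) : category := mod_cat (@Props i).

Definition J (i : cr_index) (hJ : Props (Tr (Sigma i))) : ext_cat i :=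
  exist _ (Tr (Sigma i)) hJ.

Definition R (i : cr_index) : functor (ext_cat i) base_cat :=
  forget (sig_dtor_Sigma i) (@Props i).

Definition epicorec (i : cr_index) (hJ : Props (Tr (Sigma i)))
    (hfin : final_object (J hJ)) : epi_corecursor base_obj :=
  @EpiCorecursor base_cat base_obj (ext_cat i) (J hJ) hfin (R i) erefl.

End Iterms.

Notation "cr' '>=cr' cr" := (at_least_as_strong cr' cr) (at level 70).
Notation "cr '=cr=' cr'" := (equally_strong cr cr') (at level 70).

(* Main.v *)
Require Import Defs.
From mathcomp Require Import all_boot.
From mathcomp Require Import mathcomp_extra boolp classical_sets functions.
From mathcomp Require Import cardinality.

(* A destructor-preserving map from any model to iterms is unique: two such maps
   are bisimilar, because the sets of abstraction decompositions are nonempty.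
   Hence every two morphisms of the base category into the base object coincide,
   and one epi-corecursor is at least as strong as another as soon as each model
   of the latter carries, over the same destructor, the structure of a model of
   the former. Finality reduces to the weakest structure, that of cr_5, which
   suffices to corecurse by choosing one decomposition of each abstraction.
   The conversions are 2 <-> 5, 6 -> 5, 3 -> 6, 1 <-> 3, 9 -> 1, 8 <-> 9 and 7 -> 9.
   Swapping yields permutations because the transpositions with their
   conjugation relations present the finitary symmetric group; renaming yields
   permutations by moving the support to fresh variables and back. *)

Set Implicit Arguments.
Unset Strict Implicit.
Unset Printing Implicit Defensive.

Local Open Scope classical_set_scope.

(** The coinductive [alpha] chooses a new variable at every binder, which makes even transitivity
    awkward to prove directly. It is therefore traded for equality of [sem], a function on finite
    positions, after which alpha-conversion is the algebra of [bind] on labels. As positions are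
    countable and [Var] is not, a variable fresh for given iterms always exists; in the models,
    countable exceptional sets play the role of finite supports. Corecursion from a model of cr_5
    fixes one decomposition per abstraction; [SwBvr] makes the discarded ones alpha-variants of it,
    provided that corecursion commutes with swapping, so this commutation precedes the morphism
    property. Capture-avoiding substitution must be constructed before iterms can be shown to be
    models for cr_7, cr_8 and cr_9, and it is itself such a corecursion. No corecursion is carried
    out along renaming: existence comes from the derived permutations, and commutation with renaming
    or substitution is recovered afterwards by coinduction on iterms. *)

Lemma countableU (T : Type) (A B : set T) :
  countable A -> countable B -> countable (A `|` B).
Proof.
move=> cA cB; rewrite -bigcup2E; apply: bigcup_countable => // i _.
by rewrite /bigcup2; do 2?case: ifP => // _.
Qed.

Lemma countable_subset (T : Type) (A B : set T) :
  A `<=` B -> countable B -> countable A.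
Proof. by move=> AB; apply: sub_countable; apply: subset_card_le. Qed.

Lemma countable_seq (T : eqType) (s : seq T) : countable [set x | x \in s].
Proof. exact/finite_set_countable/finite_seq. Qed.

Lemma countable_eq1 (T : Type) (a : T) : countable [set x | x = a].
Proof. by apply: countable_subset (countable1 a). Qed.

Lemma countable_image (T U : Type) (f : T -> U) (A : set T) :
  countable A -> countable (f @` A).
Proof. by apply: sub_countable; apply: card_image_le. Qed.

Section Uncountable.
Variables (T : Type) (uncT : ~ countable [set: T]).

Lemma uncountable_avoid (A : set T) : countable A -> exists x, ~ A x.
Proof.
move=> cA; apply: contrapT => /forallNP nA; apply: uncT.
by apply: countable_subset cA => x _; apply: contrapT; apply: nA.
Qed.

End Uncountable.

(** * Transpositions, renamings and finitary permutations of variables *)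

Section Swap.
Variable Var : eqType.
Implicit Types x y z : Var.

Lemma swapvL x y : swapv x y x = y. Proof. by rewrite /swapv eqxx. Qed.

Lemma swapvR x y : swapv x y y = x.
Proof. by rewrite /swapv eqxx; case: eqVneq. Qed.

Lemma swapv_id x y z : z <> x -> z <> y -> swapv x y z = z.
Proof. by move=> /eqP/negPf zx /eqP/negPf zy; rewrite /swapv zx zy. Qed.

Lemma swapvC x y : swapv x y =1 swapv y x.
Proof.
move=> z; rewrite /swapv; have [->|//] := eqVneq z x.
by case: eqVneq.
Qed.

Lemma swapvv x : swapv x x =1 id.
Proof. by move=> z; rewrite /swapv; case: eqVneq. Qed.

Lemma swapv_inj x y : injective (swapv x y).
Proof. exact: inv_inj (@swapvK _ x y). Qed.

Lemma swapv_morph (f : Var -> Var) x y z : injective f ->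
  f (swapv x y z) = swapv (f x) (f y) (f z).
Proof.
by move=> fI; rewrite /swapv !(inj_eq fI); case: ifP => // _; case: ifP.
Qed.

Lemma renvL y z : renv y z z = y. Proof. by rewrite /renv eqxx. Qed.

Lemma renv_id y z x : x <> z -> renv y z x = x.
Proof. by move=> /eqP/negPf xz; rewrite /renv xz. Qed.

Lemma eq_perm (r q : perm Var) : r =1 q -> r = q.
Proof.
case: r q => [f fb ff] [g gb gf] /= /funext e; move: e fb ff gb gf => -> *.
by congr Perm; apply: Prop_irrelevance.
Qed.

Lemma perm_inj (r : perm Var) : injective r.
Proof. exact: bij_inj (perm_bij r). Qed.

Lemma perm_inverse (r : perm Var) :
  exists q : perm Var, cancel r q /\ cancel q r.
Proof.
case: (perm_bij r) => q rK qK.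
have qb : bijective q by exists r.
have qf : finite_set [set x | q x <> x].
  apply: sub_finite_set (perm_fin r) => x /= qx rx; apply: qx.
  by rewrite -{1}rx rK.
by exists (Perm qb qf); split.
Qed.

Lemma transpC x y : transp x y = transp y x.
Proof. by apply: eq_perm => v; apply: swapvC. Qed.

Lemma transpvv x : transp x x = perm_id Var.
Proof. by apply: eq_perm => v; apply: swapvv. Qed.

End Swap.

(** * Alpha-equivalence by labelled positions *)

(* What a position of a term carries once binding occurrences are forgotten:
   [LBound k] points to the binder at depth [k] below the root; [LNone] marks
   paths that leave the term. *)
Inductive label (Var : Type) : Type :=
| LFree of Var
| LBound of nat
| LApp
| LAbs
| LNone.

Arguments LFree {Var}.
Arguments LBound {Var}.
Arguments LApp {Var}.
Arguments LAbs {Var}.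
Arguments LNone {Var}.

Section Preiterms.
Variables (Var : eqType) (uncVar : ~ countable [set: Var]).
Implicit Types (p q : preiterm Var) (rho : Var -> label Var) (x y z : Var).
Implicit Types (l : label Var) (w : seq bool).

Definition upd rho x n : Var -> label Var :=
  fun v => if v == x then LBound n else rho v.

(** Binders are numbered from the root (de Bruijn levels), with [n] of them already passed, so [rho]
    needs no shift below an abstraction. The boolean is ignored at an abstraction: both children of
    the position lead to the body. *)
Fixpoint resolve w n rho p : label Var :=
  match p, w with
  | PVr x, [::] => rho x
  | PAp _ _, [::] => LApp
  | PLm _ _, [::] => LAbs
  | PVr _, _ :: _ => LNone
  | PAp p1 p2, b :: w' => resolve w' n rho (if b then p1 else p2)
  | PLm x p', _ :: w' => resolve w' n.+1 (upd rho x n) p'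
  end.

Definition sem p w : label Var := resolve w 0 (@LFree Var) p.

Lemma pfresh_coind z (P : preiterm Var -> Prop) :
  (forall p, P p -> match p with
     | PVr x => z <> x
     | PAp p1 p2 => P p1 /\ P p2
     | PLm x p' => z = x \/ P p'
     end) ->
  forall p, P p -> pfresh z p.
Proof.
move=> H; cofix IH => p /H; case: p => [x|p1 p2|x p'].
- by move=> zx; constructor.
- by case=> /IH h1 /IH h2; constructor.
- by case=> [zx|/IH h]; constructor; [left|right].
Qed.

Lemma alpha_coind (E : preiterm Var -> preiterm Var -> Prop) :
  (forall p q, E p q -> match p, q with
     | PVr x, PVr y => x = y
     | PAp p1 p2, PAp q1 q2 => E p1 q1 /\ E p2 q2
     | PLm x p', PLm y q' => exists z, [/\ z = x \/ pfresh z p',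
         z = y \/ pfresh z q' & E (pswap p' z x) (pswap q' z y)]
     | _, _ => False
     end) ->
  forall p q, E p q -> alpha p q.
Proof.
move=> H; cofix IH => p q /H.
case: p => [x|p1 p2|x p']; case: q => [y|q1 q2|y q'] //.
- by move=> ->; constructor.
- by case=> /IH h1 /IH h2; constructor.
- by case=> z [zx zy /IH h]; apply: AlphaLm zx zy h.
Qed.

Lemma pfresh_inv z p : pfresh z p ->
  match p with
  | PVr x => z <> x
  | PAp p1 p2 => pfresh z p1 /\ pfresh z p2
  | PLm x p' => z = x \/ pfresh z p'
  end.
Proof. by case. Qed.

(* [n' - n] is the number of binders added on top of the term. *)
Lemma resolve_morph (h : label Var -> label Var) w n n' rho rho' p :
  h LApp = LApp -> h LAbs = LAbs -> h LNone = LNone ->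
  (forall k, h (LBound (n + k)) = LBound (n' + k)) ->
  (forall v, rho' v = h (rho v)) ->
  resolve w n' rho' p = h (resolve w n rho p).
Proof.
move=> hA hL hN; elim: w n n' rho rho' p => [|b w IH] n n' rho rho'.
  by case=> [x|p1 p2|x p'] hB hrho /=.
case=> [x|p1 p2|x p'] hB hrho //=; first by case: b; exact: IH.
apply: IH => [k|v]; first by rewrite !addSnnS.
by rewrite /upd; case: ifP => // _; have := hB 0; rewrite !addn0.
Qed.

(** Only variables that are not fresh for [p] are ever looked up, so the environments have to agree
    on these alone. This makes room for moving a binder to a variable fresh for the body. *)
Lemma resolve_map (f : Var -> Var) w n rho rho' p : injective f ->
  (forall v, ~ pfresh v p -> rho v = rho' (f v)) ->
  resolve w n rho p = resolve w n rho' (pre_map f p).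
Proof.
move=> fI; elim: w n rho rho' p => [|b w IH] n rho rho'.
  case=> [x|p1 p2|x p'] //= H.
  by apply: H => /pfresh_inv /(_ erefl).
case=> [x|p1 p2|x p'] //= H.
  by case: b; apply: IH => v nv; apply: H => /pfresh_inv[].
apply: IH => v nv; rewrite /upd (inj_eq fI); case: eqVneq => // vx.
by apply: H => /pfresh_inv[] // /eqP; rewrite (negPf vx).
Qed.

Lemma resolve_fresh z w n rho p :
  (forall v, rho v = LFree z -> pfresh v p) -> resolve w n rho p <> LFree z.
Proof.
elim: w n rho p => [|b w IH] n rho [x|p1 p2|x p'] //= H.
- by move=> /H /pfresh_inv.
- by case: b; apply: IH => v /H /pfresh_inv[].
- apply: IH => v; rewrite /upd; case: eqVneq => // /eqP vx /H /pfresh_inv.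
  by case.
Qed.

(** Coinduction with the existence of a suitable environment as invariant: [z] stays free in the
    environment below every binder other than [z]. *)
Lemma resolve_nfresh z n rho p : rho z = LFree z ->
  (forall w, resolve w n rho p <> LFree z) -> pfresh z p.
Proof.
move=> rz H; pose P q := exists n rho, rho z = LFree z /\
  forall w, resolve w n rho q <> LFree z.
apply: (@pfresh_coind z P); last by exists n, rho.
move=> {n rho rz H}q [n [rho [rz H]]]; case: q H => [x|p1 p2|x p'] H.
- by move=> zx; have := H [::]; rewrite /= -zx.
- by split; exists n, rho; split=> // w; [have := H (true :: w)
                                         |have := H (false :: w)].
- have [->|/eqP zx] := eqVneq z x; [by left|right].
  exists n.+1, (upd rho x n); split; last by move=> w; have := H (true :: w).
  by rewrite /upd; case: eqVneq zx.
Qed.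

Lemma sem_fresh z p : pfresh z p <-> forall w, sem p w <> LFree z.
Proof.
split; last by apply: resolve_nfresh.
by move=> zp w; apply: resolve_fresh => v [->].
Qed.

(** A variable that is not fresh labels some position; positions are countably many and each carries
    at most one variable. *)
Lemma countable_nfresh p : countable [set x | ~ pfresh x p].
Proof.
apply: (@countable_subset _ _
  (\bigcup_(w in [set: seq bool]) [set x | sem p w = LFree x])).
  move=> x /= /sem_fresh /existsNP[w /contrapT wx]; by exists w.
apply: bigcup_countable; first exact: countableP.
move=> w _; case: (sem p w) => [y|k|||];
  try by apply: countable_subset (@countable0 Var) => x.
by apply: countable_subset (countable_eq1 y) => x /= [].
Qed.

Definition lmap (f : Var -> Var) l : label Var :=
  if l is LFree x then LFree (f x) else l.

Lemma sem_map f p w : injective f -> sem (pre_map f p) w = lmap f (sem p w).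
Proof.
move=> fI; rewrite /sem -(@resolve_map f w 0 (LFree \o f)) //.
exact: resolve_morph.
Qed.

Lemma pfresh_map f p x : injective f ->
  pfresh (f x) (pre_map f p) <-> pfresh x p.
Proof.
move=> fI; rewrite !sem_fresh; split=> H w; have := H w; rewrite sem_map //.
  by move=> fx e; apply: fx; rewrite e.
by case: (sem p w) => //= y yx [] /fI e; apply: yx; rewrite e.
Qed.

(** Both abstracted variables are moved to the [z] supplied by [AlphaLm]; the swapped bodies are
    then read in one environment and are again related by [alpha], so the induction on positions
    goes on. *)
Lemma alpha_resolve p q w n rho : alpha p q ->
  resolve w n rho p = resolve w n rho q.
Proof.
have freshen z x p' b w' n' rho' : z = x \/ pfresh z p' ->
    resolve (b :: w') n' rho' (PLm x p') =
    resolve w' n'.+1 (upd rho' z n') (pswap p' z x).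
  move=> zx /=; apply: resolve_map => [|v nv]; first exact: swapv_inj.
  rewrite /upd; have [->|/eqP vx] := eqVneq v x; first by rewrite swapvR eqxx.
  have vz : v <> z by case: zx => [->//|zp] e; apply: nv; rewrite e.
  by rewrite swapv_id //; case: eqVneq.
elim: w n rho p q => [|b w IH] n rho _ _ [x|p1 p2 q1 q2 h1 h2|x y p q z zx zy h];
  try by [].
  by case: b; apply: IH.
by rewrite (freshen _ _ _ b _ _ _ zx) (freshen _ _ _ b _ _ _ zy); apply: IH.
Qed.

Lemma sem_alpha p q : (forall w, sem p w = sem q w) -> alpha p q.
Proof.
pose good n rho := forall v, match rho v with
  | LFree _ => True | LBound k => k < n | _ => False end.
pose occ p q := [set u | ~ pfresh u p \/ ~ pfresh u q].
pose E p q := exists n rho, [/\ good n rho,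
  forall u v, occ p q u -> occ p q v -> rho u = rho v -> u = v &
  forall w, resolve w n rho p = resolve w n rho q].
move=> H; apply: (@alpha_coind E); last first.
  by exists 0, (@LFree Var); split=> // u v _ _ [].
move=> {p q H}p q [n [rho [rn rI H]]].
case: p q rI H => [x|p1 p2|x p] [y|q1 q2|y q] rI H //=;
  try by have /= e := H [::]; try ((have := rn x; rewrite e) ||
                              (have := rn y; rewrite -e)).
- apply: rI; last exact: (H [::]).
    by left=> /pfresh_inv /(_ erefl).
  by right=> /pfresh_inv /(_ erefl).
- split; exists n, rho; split=> //.
  + by move=> u v ou ov; apply: rI; [case: ou|case: ov] => h;
       [left|right|left|right]; move=> /pfresh_inv[].
  + by move=> w; have := H (true :: w).
  + by move=> u v ou ov; apply: rI; [case: ou|case: ov] => h;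
       [left|right|left|right]; move=> /pfresh_inv[].
  + by move=> w; have := H (false :: w).
have [z zpq] : exists z, ~ occ p q z.
  apply: uncountable_avoid uncVar _ _.
  exact: countableU (countable_nfresh p) (countable_nfresh q).
have zp : pfresh z p by apply: contrapT => h; apply: zpq; left.
have zq : pfresh z q by apply: contrapT => h; apply: zpq; right.
have step x' p' w : pfresh z p' -> resolve w n.+1 (upd rho x' n) p' =
    resolve w n.+1 (upd rho z n) (pswap p' z x').
  move=> zp'; apply: resolve_map => [|v nv]; first exact: swapv_inj.
  rewrite /upd; have [->|/eqP vx] := eqVneq v x'; first by rewrite swapvR eqxx.
  have vz : v <> z by move=> e; apply: nv; rewrite e.
  by rewrite swapv_id //; case: eqVneq.
exists z; split; [by right|by right|].
(* Variables of the swapped body other than [z] were already free in the abstraction, which gives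
   the injectivity of the extended environment. *)
have fr_swap x' p' u : pfresh z p' -> ~ pfresh u (pswap p' z x') ->
    u = z \/ ~ pfresh u (PLm x' p').
  move=> zp' nu; have [->|/eqP uz] := eqVneq u z; [by left|right].
  move=> /pfresh_inv h; apply: nu.
  have [ux|/eqP ux] := eqVneq u x'.
    by rewrite ux -[x' in pfresh x'](swapvL z x'); apply/pfresh_map/zp';
       apply: swapv_inj.
  rewrite -[u](swapv_id uz ux); apply/pfresh_map; first exact: swapv_inj.
  by case: h.
exists n.+1, (upd rho z n); split.
- move=> v; rewrite /upd; case: eqVneq => // _; have := rn v.
  by case: (rho v) => // k; apply: leqW.
- have occE u : occ (pswap p z x) (pswap q z y) u ->
      u = z \/ occ (PLm x p) (PLm y q) u.
    by case=> /fr_swap[] //; [left|right; left|left|right; right].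
  have fresh_bound v : rho v <> LBound n.
    by move=> e; have := rn v; rewrite e ltnn.
  move=> u v; rewrite /upd => /occE ou /occE ov.
  case: eqVneq => [->|/eqP uz]; case: eqVneq => [->|/eqP vz] //.
  + by move=> /esym /fresh_bound.
  + by move=> /fresh_bound.
  + by case: ou ov => // ou [] // ov; apply: rI.
- by move=> w; rewrite -!step //; have := H (true :: w).
Qed.

End Preiterms.

(** * Iterms *)

Section ItermTheory.
Variables (Var : eqType) (uncVar : ~ countable [set: Var]).
Implicit Types (p q : preiterm Var) (x y z : Var) (t u s : iterm Var).
Implicit Types (l : label Var) (w : seq bool).

(** Effect on labels of one more abstraction at the root: the new binder takes level 0 and the
    levels already present move up by one. *)
Definition bind x l : label Var :=
  match l with
  | LFree v => if v == x then LBound 0 else LFree v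
  | LBound k => LBound k.+1
  | _ => l
  end.

Lemma bind_inj x : injective (bind x).
Proof.
case=> [u|i|||] [v|j|||] //=; try (by case: eqVneq); last by case=> ->.
by case: eqVneq => [->|_]; case: eqVneq => [->|_] // [->].
Qed.

Lemma bind_swap x y l : y = x \/ l <> LFree y ->
  bind y (lmap (swapv y x) l) = bind x l.
Proof.
case: l => [v|k|||] //= H; have [->|/eqP vx] := eqVneq v x.
  by rewrite swapvR eqxx.
have vy : v <> y by case: H => [->//|H] e; apply: H; rewrite e.
by rewrite swapv_id //; case: eqVneq vy.
Qed.

Lemma lmap_bind (f : Var -> Var) x l : injective f ->
  lmap f (bind x l) = bind (f x) (lmap f l).
Proof.
by move=> fI; case: l => //= v; rewrite (inj_eq fI); case: ifP.
Qed.

Lemma sem_PLm x p w : sem (PLm x p) w =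
  if w is _ :: w' then bind x (sem p w') else LAbs.
Proof.
case: w => //= b w; exact: (@resolve_morph _ (bind x) w 0 1).
Qed.

(** In particular [alpha] is an equivalence relation, being the pullback of pointwise equality along
    [sem]. *)
Lemma alphaP p q : alpha p q <-> sem p =1 sem q.
Proof.
split=> [pq w|]; first exact: alpha_resolve.
exact: sem_alpha.
Qed.

Lemma iclass_eq p q : iclass p = iclass q <-> sem p =1 sem q.
Proof.
split=> [[e]|e].
  have : [set r | alpha p r] p by apply/alphaP.
  by rewrite e => /alphaP qp w; rewrite qp.
apply: eq_exist; apply/seteqP; split=> r /=; rewrite !alphaP => h w.
  by rewrite -e.
by rewrite e.
Qed.

Lemma ireprK t : iclass (irepr t) = t.
Proof.
case: t => X hX; apply: eq_exist; rewrite /irepr.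
by case: cid => p /= ->.
Qed.

Definition isem t : seq bool -> label Var := sem (irepr t).

Lemma isem_inj t u : isem t =1 isem u -> t = u.
Proof. by move=> e; rewrite -[t]ireprK -[u]ireprK; apply/iclass_eq. Qed.

Lemma isem_class p : isem (iclass p) =1 sem p.
Proof. exact/iclass_eq/ireprK. Qed.

Lemma isem_Vr x w : isem (iVr x) w = if w is [::] then LFree x else LNone.
Proof. by rewrite isem_class; case: w. Qed.

Lemma isem_Ap t u w :
  isem (iAp t u) w = if w is b :: w' then isem (if b then t else u) w' else LApp.
Proof. by rewrite isem_class; case: w => // b w; case: b. Qed.

Lemma isem_Lm x t w :
  isem (iLm x t) w = if w is _ :: w' then bind x (isem t w') else LAbs.
Proof. by rewrite isem_class sem_PLm. Qed.

Lemma isem_perm t (r : perm Var) w : isem (iperm t r) w = lmap r (isem t w).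
Proof. by rewrite isem_class sem_map //; apply: perm_inj. Qed.

Lemma iswapE t x y : iswap t x y = iperm t (transp x y).
Proof. by []. Qed.

Lemma isem_swap t x y w : isem (iswap t x y) w = lmap (swapv x y) (isem t w).
Proof. exact: (isem_perm t (transp x y)). Qed.

Lemma iclass_PAp p q : iclass (PAp p q) = iAp (iclass p) (iclass q).
Proof.
apply/iclass_eq => -[|b w] //=.
by rewrite /sem /=; case: b; rewrite -/(sem _ w) -/(sem _ w);
  exact/esym/isem_class.
Qed.

Lemma iclass_PLm x p : iclass (PLm x p) = iLm x (iclass p).
Proof.
apply/iclass_eq => -[|b w] //; rewrite !sem_PLm.
by congr bind; exact/esym/isem_class.
Qed.

Lemma iterm_case t : [\/ exists x, t = iVr x, exists t1 t2, t = iAp t1 t2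
  | exists x t', t = iLm x t'].
Proof.
rewrite -[t]ireprK; case: (irepr t) => [x|p q|x p].
- by constructor 1; exists x.
- by constructor 2; exists (iclass p), (iclass q); apply: iclass_PAp.
- by constructor 3; exists x, (iclass p); apply: iclass_PLm.
Qed.

Lemma iVr_inj : injective (@iVr Var).
Proof. by move=> x y /(congr1 (isem^~ [::])); rewrite !isem_Vr => -[]. Qed.

Lemma iAp_inj t1 t2 u1 u2 : iAp t1 t2 = iAp u1 u2 -> t1 = u1 /\ t2 = u2.
Proof.
move=> e; split; apply: isem_inj => w.
  by have := congr1 (isem^~ (true :: w)) e; rewrite !isem_Ap.
by have := congr1 (isem^~ (false :: w)) e; rewrite !isem_Ap.
Qed.

Lemma iVr_neq_Ap x t1 t2 : iVr x <> iAp t1 t2.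
Proof. by move=> /(congr1 (isem^~ [::])); rewrite isem_Vr isem_Ap. Qed.

Lemma iVr_neq_Lm x y t : iVr x <> iLm y t.
Proof. by move=> /(congr1 (isem^~ [::])); rewrite isem_Vr isem_Lm. Qed.

Lemma iAp_neq_Lm t1 t2 y t : iAp t1 t2 <> iLm y t.
Proof. by move=> /(congr1 (isem^~ [::])); rewrite isem_Ap isem_Lm. Qed.

Lemma ifreshP z t : ifresh z t <-> forall w, isem t w <> LFree z.
Proof. exact: sem_fresh. Qed.

Lemma ifresh_countable t : countable [set x | ~ ifresh x t].
Proof. exact: countable_nfresh. Qed.

(** If [y], different from [x], labelled a position of [t], the left side would show [LFree y]
    there, which [bind y] never produces on the right. Once [y] is known to be harmless, [bind y]
    occurs on both sides and is cancelled by injectivity. *)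
Lemma iLm_eq x y t u :
  iLm x t = iLm y u <-> (y = x \/ ifresh y t) /\ u = iswap t y x.
Proof.
split=> [e|[yt ->]]; last first.
  apply: isem_inj => -[|b w]; rewrite !isem_Lm // isem_swap bind_swap //.
  by case: yt => [|/ifreshP yt]; [left|right].
have e' w : bind x (isem t w) = bind y (isem u w).
  by have := congr1 (isem^~ (true :: w)) e; rewrite !isem_Lm.
have yt : y = x \/ ifresh y t.
  have [|/eqP yx] := eqVneq y x; first by left.
  right; apply/ifreshP => w tw; have := e' w; rewrite tw /=.
  case: eqVneq yx => // _ _; case: (isem u w) => //= v.
  by case: eqVneq => // vy [] /esym /eqP; rewrite (negPf vy).
split=> //; apply: isem_inj => w; apply: (@bind_inj y).
rewrite -e' isem_swap bind_swap //.
by case: yt => [|/ifreshP yt]; [left|right].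
Qed.

Lemma ifresh_Vr z x : ifresh z (iVr x) <-> z <> x.
Proof.
rewrite ifreshP; split=> [H e|zx [|b w]]; rewrite ?isem_Vr //.
  by apply: (H [::]); rewrite isem_Vr e.
by case=> /esym.
Qed.

Lemma ifresh_Ap z t u : ifresh z (iAp t u) <-> ifresh z t /\ ifresh z u.
Proof.
rewrite !ifreshP; split=> [H|[ht hu] [|[] w]]; rewrite ?isem_Ap //.
by split=> w; [have := H (true :: w)|have := H (false :: w)]; rewrite isem_Ap.
Qed.

Lemma ifresh_Lm z x t : ifresh z (iLm x t) <-> z = x \/ ifresh z t.
Proof.
rewrite !ifreshP; split=> [H|H [|b w]]; rewrite ?isem_Lm //.
  have [|/eqP zx] := eqVneq z x; first by left.
  right=> w tw; apply: (H (true :: w)); rewrite isem_Lm tw /=.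
  by case: eqVneq zx.
case tw: (isem t w) => [v|k|||] //=; case: eqVneq => // /eqP vx [] vz.
case: H => [zx|/(_ w)]; first by apply: vx; rewrite vz.
by rewrite tw vz.
Qed.

(* Positions are finite, so coinduction on iterms is induction on positions. *)
Lemma iterm_coind (E : iterm Var -> iterm Var -> Prop) :
  (forall t u, E t u -> [\/ t = u,
     exists t1 t2 u1 u2, [/\ t = iAp t1 t2, u = iAp u1 u2, E t1 u1 & E t2 u2] |
     exists x t' u', [/\ t = iLm x t', u = iLm x u' & E t' u']]) ->
  forall t u, E t u -> t = u.
Proof.
move=> H t u tu; apply: isem_inj => w; elim: w t u tu => [|b w IH] t u /H.
  case=> [->//|[t1 [t2 [u1 [u2 [-> -> _ _]]]]]|[x [t' [u' [-> -> _]]]]].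
    by rewrite !isem_Ap.
  by rewrite !isem_Lm.
case=> [->//|[t1 [t2 [u1 [u2 [-> -> h1 h2]]]]]|[x [t' [u' [-> -> h]]]]].
  by rewrite !isem_Ap; case: b; apply: IH.
by rewrite !isem_Lm (IH _ _ h).
Qed.

Lemma ifresh_coind z (P : iterm Var -> Prop) :
  (forall t, P t -> [\/ ifresh z t,
     exists t1 t2, [/\ t = iAp t1 t2, P t1 & P t2] |
     exists x t', t = iLm x t' /\ (z = x \/ P t')]) ->
  forall t, P t -> ifresh z t.
Proof.
move=> H t Pt; apply/ifreshP => w; elim: w t Pt => [|b w IH] t /H.
  case=> [/ifreshP//|[t1 [t2 [-> _ _]]]|[x [t' [-> _]]]].
    by rewrite isem_Ap.
  by rewrite isem_Lm.
case=> [/ifreshP//|[t1 [t2 [-> h1 h2]]]|[x [t' [-> h]]]].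
  by rewrite isem_Ap; case: b; apply: IH.
rewrite isem_Lm; case tw: (isem t' w) => [v|k|||] //=.
case: eqVneq => // /eqP vx [] vz.
case: h => [zx|/IH]; first by apply: vx; rewrite vz.
by rewrite tw vz.
Qed.

Lemma iperm_Vr x (r : perm Var) : iperm (iVr x) r = iVr (r x).
Proof.
by apply: isem_inj => -[|b w]; rewrite isem_perm !isem_Vr.
Qed.

Lemma iperm_Ap t u (r : perm Var) : iperm (iAp t u) r = iAp (iperm t r) (iperm u r).
Proof.
apply: isem_inj => -[|b w]; rewrite isem_perm !isem_Ap //.
by case: b; rewrite isem_perm.
Qed.

Lemma iperm_Lm x t (r : perm Var) : iperm (iLm x t) r = iLm (r x) (iperm t r).
Proof.
apply: isem_inj => -[|b w]; rewrite isem_perm !isem_Lm //.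
by rewrite isem_perm lmap_bind //; apply: perm_inj.
Qed.

Lemma iperm_id t : iperm t (perm_id Var) = t.
Proof. by apply: isem_inj => w; rewrite isem_perm; case: (isem t w). Qed.

Lemma iperm_comp t (r q : perm Var) :
  iperm (iperm t r) q = iperm t (perm_comp q r).
Proof. by apply: isem_inj => w; rewrite !isem_perm; case: (isem t w). Qed.

Lemma iperm_fix t (r : perm Var) :
  (forall x, r x <> x -> ifresh x t) -> iperm t r = t.
Proof.
move=> H; apply: isem_inj => w; rewrite isem_perm.
case tw: (isem t w) => [v|k|||] //=.
have [->//|/eqP rv] := eqVneq (r v) v.
by have /ifreshP/(_ w)/(_ tw) := H _ rv.
Qed.

Lemma ifresh_perm x t (r : perm Var) : ifresh (r x) (iperm t r) <-> ifresh x t.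
Proof.
rewrite !ifreshP; split=> H w; have := H w; rewrite isem_perm.
  by move=> rx e; apply: rx; rewrite e.
by case: (isem t w) => //= y yx [] /perm_inj e; apply: yx; rewrite e.
Qed.

(** The variable convention for infinitary terms: a binder can be moved out of any countable set. *)
Lemma iLm_avoid x t (X : set Var) : countable X ->
  exists y u, [/\ iLm x t = iLm y u, ~ X y & ifresh y t].
Proof.
move=> cX.
have [y /not_orP[Xy ty]] := uncountable_avoid uncVar
  (countableU cX (ifresh_countable t)).
have {}ty : ifresh y t by apply: contrapT.
by exists y, (iswap t y x); split=> //; apply/iLm_eq; split=> //; right.
Qed.

Lemma idest_Vr x : idest (iVr x) = V _ x.
Proof.
rewrite /idest; case: pselect => [h|[]]; last by exists x.
by congr V; apply: iVr_inj; case: (cid h).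
Qed.

Lemma idest_Ap t u : idest (iAp t u) = A _ t u.
Proof.
rewrite /idest; case: pselect => [[x /esym/iVr_neq_Ap//]|_].
case: pselect => [h|[]]; last by exists (t, u).
by case: (cid h) => -[t' u'] /= /iAp_inj[-> ->].
Qed.

Lemma idest_Lm x t : exists2 K, idest (iLm x t) = L K &
  forall y u, sval K (y, u) <-> iLm x t = iLm y u.
Proof.
rewrite /idest; case: pselect => [[y /esym/iVr_neq_Lm//]|_].
case: pselect => [[[t1 t2] /esym/iAp_neq_Lm//]|_].
case: pselect => [h|[]]; last by exists (x, t).
by eexists.
Qed.

Lemma idestV t x : idest t = V _ x <-> t = iVr x.
Proof.
split=> [|->]; last exact: idest_Vr.
case: (iterm_case t) => [[y ->]|[t1 [t2 ->]]|[y [t' ->]]].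
- by rewrite idest_Vr => -[->].
- by rewrite idest_Ap.
- by have [K ->] := idest_Lm y t'.
Qed.

Lemma idestA t t1 t2 : idest t = A _ t1 t2 <-> t = iAp t1 t2.
Proof.
split=> [|->]; last exact: idest_Ap.
case: (iterm_case t) => [[y ->]|[u1 [u2 ->]]|[y [t' ->]]].
- by rewrite idest_Vr.
- by rewrite idest_Ap => -[-> ->].
- by have [K ->] := idest_Lm y t'.
Qed.

Lemma idestL t K : idest t = L K -> forall y u, sval K (y, u) <-> t = iLm y u.
Proof.
case: (iterm_case t) => [[y ->]|[u1 [u2 ->]]|[y [t' ->]]].
- by rewrite idest_Vr.
- by rewrite idest_Ap.
- by have [K' -> H] := idest_Lm y t' => -[<-].
Qed.

End ItermTheory.

(** * From swapping to permutations *)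

Section SwapLists.
Variable Var : eqType.
Implicit Types (x y z a b : Var) (l : seq (Var * Var)) (X : pred Var).

Definition swaps_fun l v := foldl (fun v p => swapv p.1 p.2 v) v l.

Definition swaps_in X l := all (fun p => X p.1 && X p.2) l.

Lemma swaps_fun_cat l1 l2 v :
  swaps_fun (l1 ++ l2) v = swaps_fun l2 (swaps_fun l1 v).
Proof. exact: foldl_cat. Qed.

Lemma swaps_fun_inj l : injective (swaps_fun l).
Proof.
elim: l => [|p l IH] u v; first by [].
by move=> /= /IH /swapv_inj.
Qed.

Lemma swaps_fun_fix a l : swaps_in (predC1 a) l -> swaps_fun l a = a.
Proof.
elim: l => //= p l IH /andP[/andP[/= ap1 ap2] /IH h].
by rewrite /= swapv_id //; apply/eqP; rewrite eq_sym.
Qed.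

Lemma swaps_fun_rev l : cancel (swaps_fun l) (swaps_fun (rev l)).
Proof.
elim: l => // p l IH v.
by rewrite rev_cons -cats1 swaps_fun_cat /= IH swapvK.
Qed.

(** Composing with the transposition of [a] and [f a] makes [a] a fixed point and keeps the old
    fixed points, so the support shrinks. The swaps are confined to moved variables because in a
    model only these may be known to be fresh. *)
Lemma swaps_of_fun (s : seq Var) (f : Var -> Var) : injective f ->
  (forall v, f v <> v -> v \in s) ->
  exists2 l, swaps_fun l =1 f & swaps_in (fun v => f v != v) l.
Proof.
elim: s f => [|a s IH] f fI fs.
  by exists [::] => // v; apply: contrapT => /nesym fv; have := fs v fv.
have [fa|fa] := eqVneq (f a) a.
  apply: IH => // v fv; have := fs v fv; rewrite inE => /orP[/eqP va|//].
  by case: fv; rewrite va.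
have gI : injective (swapv a (f a) \o f) by move=> u v /= /swapv_inj /fI.
have fix_f v : f v = v -> swapv a (f a) (f v) = v.
  move=> fv; rewrite fv swapv_id // => va; first by rewrite -va fv eqxx in fa.
  by move: fv; rewrite va => /fI e; rewrite e eqxx in fa.
have [||l lE lf] := IH (swapv a (f a) \o f) => //=.
  move=> v gv; have va : v <> a by move=> e; apply: gv; rewrite e /= swapvR.
  have : v \in a :: s by apply: fs => fv; apply/gv/fix_f.
  by rewrite inE => /orP[/eqP|].
exists (rcons l (a, f a)).
  by move=> v; rewrite -cats1 swaps_fun_cat lE /= swapvK.
rewrite /swaps_in all_rcons /= fa /= (inj_eq fI) fa /=.
apply: sub_all lf => -[u v] /= /andP[hu hv].
by apply/andP; split; [apply: contra_neq hu|apply: contra_neq hv] => /fix_f.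
Qed.

End SwapLists.

Section SwapAction.
Variables (Var : eqType) (M : Type) (sw : M -> Var -> Var -> M).
Hypotheses (swId : SwId sw) (swIv : SwIv sw) (swCp : SwCp sw).
Implicit Types (t : M) (x y z a b : Var) (l : seq (Var * Var)).

Definition swaps t l : M := foldl (fun t p => sw t p.1 p.2) t l.

(** Conjugating a swap by itself with [SwCp] exchanges its arguments. *)
Lemma sw_sym t x y : sw t x y = sw t y x.
Proof.
have := swCp t x y x y; rewrite swIv swapvL swapvR => e.
by rewrite [in RHS]e swIv.
Qed.

Lemma swaps_cat t l1 l2 : swaps t (l1 ++ l2) = swaps (swaps t l1) l2.
Proof. exact: foldl_cat. Qed.

Lemma swaps_rev t l : swaps (swaps t (rev l)) l = t.
Proof.
elim: l t => // p l IH t.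
by rewrite rev_cons -cats1 swaps_cat /= swIv; apply: IH.
Qed.

(** The rewriting step of the word problem: all swaps involving [a] are merged into one leading
    swap, and the rest avoids [a]. The actions on the model and on variables are tracked together,
    as one rewriting of the word serves both. *)
Lemma swaps_isolate a (X : pred Var) l : swaps_in X l -> exists b l',
  [/\ b = a \/ X b, swaps_in (predI X (predC1 a)) l',
      forall t, swaps t l = swaps (sw t a b) l' &
      forall v, swaps_fun l v = swaps_fun l' (swapv a b v)].
Proof.
elim: l => [|[x y] l IH] /=.
  by exists a, [::]; split=> // [|t|v]; [left|rewrite /= swId|rewrite /= swapvv].
move=> /andP[/andP[/= Xx Xy] /IH[b [l' [Xb l'X l'E l'f]]]].
(* Adjacent swaps of [a] with [z] and then with a different [b] become one swap of [a] and [b]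
   followed by a swap of [b] and [z]; equal or trivial ones collapse. *)
have isolate_head z : X z -> exists c l'',
    [/\ c = a \/ X c, swaps_in (predI X (predC1 a)) l'',
        forall t, swaps (sw (sw t a z) a b) l' = swaps (sw t a c) l'' &
        forall v, swaps_fun l' (swapv a b (swapv a z v)) =
                  swaps_fun l'' (swapv a c v)].
  move=> Xz; have [zb|/eqP zb] := eqVneq z b.
    exists a, l'; split=> // [|t|v]; [by left| |].
      by rewrite zb swIv swId.
    by rewrite zb swapvK swapvv.
  case: Xb => [ba|Xb].
    exists z, l'; split=> // [|t|v]; [by right| |].
      by rewrite ba swId.
    by rewrite ba swapvv.
  have [za|za] := eqVneq z a.
    exists b, l'; split=> // [|t|v]; [by right| |].
      by rewrite za swId.
    by rewrite za swapvv.
  have [ba|ba] := eqVneq b a.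
    exists z, l'; split=> // [|t|v]; [by right| |].
      by rewrite ba swId.
    by rewrite ba swapvv.
  exists b, ((b, z) :: l'); split=> // [|/=|t|v].
  - by right.
  - by rewrite Xb Xz ba za.
  - by rewrite /= swCp swapvL swapv_id //; apply/eqP.
  - rewrite /= (swapv_morph a z v (@swapv_inj _ a b)) swapvL.
    by rewrite [swapv a b z]swapv_id //; apply/eqP.
have [xa|xa] := eqVneq x a.
  have [c [l'' [Xc l''X E Ef]]] := isolate_head y Xy.
  by exists c, l''; split=> // [t|v]; rewrite xa ?l'E ?l'f ?E ?Ef.
have [ya|ya] := eqVneq y a.
  have [c [l'' [Xc l''X E Ef]]] := isolate_head x Xx.
  exists c, l''; split=> // [t|v]; first by rewrite ya l'E (sw_sym t x a) E.
  by rewrite ya l'f (swapvC x a) Ef.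
have axy : swapv x y a = a by rewrite swapv_id //; apply/eqP; rewrite eq_sym.
(* A swap avoiding [a] is carried behind the leading swap, whose partner [b] is replaced by its
   image. *)
exists (swapv x y b), ((x, y) :: l'); split.
- case: Xb => [->|Xb]; first by left.
  by right; rewrite /swapv; do 2?case: ifP.
- by rewrite /= l'X Xx Xy xa ya.
- by move=> t /=; rewrite l'E [in RHS]swCp swapvK axy.
- move=> v /=; rewrite l'f (swapv_morph _ _ _ (@swapv_inj _ x y)) swapvK.
  by rewrite axy.
Qed.

(** A word acting as the identity fixes [a], and so does its part avoiding [a]; hence the leading
    swap isolated for [a] is trivial, and a word in one variable fewer remains. *)
Lemma swaps_id (s : seq Var) l t : swaps_in (mem s) l ->
  swaps_fun l =1 id -> swaps t l = t.
Proof.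
elim: s l t => [|a s IH] l t ls lE; first by case: l ls {lE} => // p l /andP[].
have [b [l' [_ l'X -> l'f]]] := swaps_isolate a ls.
have l'a : swaps_fun l' a = a.
  apply: swaps_fun_fix; apply: sub_all l'X => -[u v] /=.
  by case/andP=> /andP[_ ->] /andP[_ ->].
have ba : b = a.
  by apply: (@swaps_fun_inj _ l'); rewrite l'a -{1}(swapvL a b) -l'f lE.
rewrite ba swId; apply: IH => [|v]; last by rewrite -[RHS]lE l'f ba swapvv.
apply: sub_all l'X => -[u v] /= /andP[/andP[uas ua] /andP[vas va]].
by move: uas vas; rewrite !inE (negPf ua) (negPf va) /= => -> ->.
Qed.

Lemma swaps_eq l1 l2 t : swaps_fun l1 =1 swaps_fun l2 -> swaps t l1 = swaps t l2.
Proof.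
move=> e; pose s := flatten [seq [:: p.1; p.2] | p <- l2 ++ rev l1].
have st : swaps t (l2 ++ rev l1) = t.
  apply: (@swaps_id s) => [|v]; last by rewrite swaps_fun_cat -e swaps_fun_rev.
  apply/allP => p pl.
  by apply/andP; split; apply/flatten_mapP; exists p; rewrite ?inE ?eqxx ?orbT.
by rewrite -{1}st swaps_cat swaps_rev.
Qed.

Lemma swaps_preserves_dest (dest : M -> Defs.shape Var M) :
  SwVr dest sw -> SwAp dest sw -> SwLm dest sw ->
  [/\ forall l t x, dest t = V M x -> dest (swaps t l) = V M (swaps_fun l x),
      forall l t t1 t2, dest t = A _ t1 t2 ->
        dest (swaps t l) = A _ (swaps t1 l) (swaps t2 l) &
      forall l t K, dest t = L K -> exists K', dest (swaps t l) = L K' /\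
        forall x t', sval K (x, t') -> sval K' (swaps_fun l x, swaps t' l)].
Proof.
move=> swVr swAp swLm; split; elim=> [|[y z] l IH] t /=.
- by [].
- by move=> x tx; apply: IH; apply: swVr.
- by [].
- by move=> t1 t2 /swAp tA; apply: IH.
- by move=> K tK; exists K.
- move=> K /swLm-/(_ y z)[K1 [/IH[K' [tK' KK']] KK1]]; exists K'; split=> // x t'.
  by move=> /KK1/KK'.
Qed.

(** By [swaps_eq] all words of swaps representing [r] act alike, so one is chosen. Choosing a word
    in moved variables serves the fourth clause, the source of [PmFv]. *)
Lemma perm_of_swap : exists pm : M -> perm Var -> M,
  [/\ PmId pm, PmCp pm, forall t x y, pm t (transp x y) = sw t x y,
      forall t (r : perm Var), (forall x y, r x <> x -> r y <> y ->
        sw t x y = t) -> pm t r = t &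
      forall dest, SwVr dest sw -> SwAp dest sw -> SwLm dest sw ->
        [/\ PmVr dest pm, PmAp dest pm & PmLm dest pm]].
Proof.
have swaps_of (r : perm Var) :
    exists l, swaps_fun l =1 r /\ swaps_in (fun v => r v != v) l.
  have [s rs] := (finite_seqP _).1 (perm_fin r).
  have [|l lr lin] := @swaps_of_fun _ s r (@perm_inj _ r); last by exists l.
  by move=> v rv; have : [set x | r x <> x] v by []; rewrite rs.
pose lst (r : perm Var) := sval (cid (swaps_of r)).
have lstE (r : perm Var) : swaps_fun (lst r) =1 r by rewrite /lst; case: cid => l [].
have lst_in (r : perm Var) : swaps_in (fun v => r v != v) (lst r).
  by rewrite /lst; case: cid => l [].
exists (fun t (r : perm Var) => swaps t (lst r)); split.
- by move=> t; apply: (@swaps_eq _ [::]) => v; rewrite lstE.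
- move=> t r q; rewrite -swaps_cat; apply: swaps_eq => v.
  by rewrite swaps_fun_cat !lstE.
- by move=> t x y; apply: (@swaps_eq _ [:: (x, y)]) => v; rewrite lstE.
- move=> t r rt; elim: (lst r) (lst_in r) => //= p l IH.
  by case/andP=> /andP[/eqP r1 /eqP r2] /IH; rewrite rt.
- move=> dest swVr swAp swLm.
  have [Hv Ha Hl] := swaps_preserves_dest swVr swAp swLm; split.
  + by move=> t x r /Hv ->; rewrite lstE.
  + by move=> t t1 t2 r; apply: Ha.
  + move=> t K r /Hl-/(_ (lst r))[K' [tK' KK']]; exists K'; split=> // x t'.
    by move=> /KK'; rewrite lstE.
Qed.

End SwapAction.

(** * From renaming to permutations *)

Section RenamingAction.
Variables (Var : eqType) (uncVar : ~ countable [set: Var]).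
Variables (M : Type) (ren : M -> Var -> Var -> M) (fr : Var -> M -> Prop).
Hypotheses (rnId : RnId ren) (rnChFr : RnChFr ren fr) (rnCm : RnCm ren).
Hypotheses (rnFr : RnFr ren fr) (frRn : FrRn ren fr) (frSup : FSupFr fr).
Implicit Types (t : M) (x y z a : Var) (s : seq Var) (f g h w : Var -> Var).
Implicit Types (r q : perm Var).

(** Sources and targets are families indexed by [s], so that a renaming can be reindexed along a
    permutation. *)
Definition rename_seq s f g t := foldl (fun t x => ren t (g x) (f x)) t s.

Lemma rename_seq_comp s f g h t :
  rename_seq [seq h v | v <- s] f g t = rename_seq s (f \o h) (g \o h) t.
Proof. by rewrite /rename_seq; elim: s t => //= a s IH t; rewrite IH. Qed.

Lemma fr_rename_seq s f g t z : {in s, forall v, g v <> z} ->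
  fr z t \/ (exists2 v, v \in s & z = f v) -> fr z (rename_seq s f g t).
Proof.
rewrite /rename_seq; elim: s t => /= [|a s IH] t gz; first by case=> // -[].
move=> zt; apply: IH => [v vs|]; first by apply: gz; rewrite inE vs orbT.
have ga : g a <> z by apply: gz; rewrite inE eqxx.
case: zt => [zt|[v]]; first by left; apply/frRn; split; right.
rewrite inE => /orP[/eqP va zv|vs zv]; last by right; exists v.
by left; apply/frRn; split; [left; rewrite zv va|right].
Qed.

Lemma rename_seq_comm s f g t x y :
  {in s, forall v, [/\ g v <> x, f v <> x & f v <> y]} ->
  ren (rename_seq s f g t) y x = rename_seq s f g (ren t y x).
Proof.
rewrite /rename_seq; elim: s t => //= a s IH t H.
have [gx fx fy] := H a (mem_head a s).
rewrite IH => [|v vs]; last by apply: H; rewrite inE vs orbT.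
by congr foldl; apply: rnCm => // /esym.
Qed.

(** Each renaming of the second pass commutes past the unrelated ones of the first until it meets
    its partner, where [RnChFr] fuses the two. *)
Lemma rename_seq_chain s f g h t : uniq s -> {in s &, injective g} ->
  {in s &, forall u v, [/\ f u <> g v, f u <> h v & g u <> h v]} ->
  {in s, forall v, fr (g v) t} ->
  rename_seq s g h (rename_seq s f g t) = rename_seq s f h t.
Proof.
elim: s t => // a s IH t /= /andP[as_ us] gI H gt.
have sub v : v \in s -> v \in a :: s by rewrite inE orbC => ->.
have aas := mem_head a s.
rewrite /rename_seq /= -/(rename_seq _ _ _ _) -/(rename_seq s f g _).
rewrite rename_seq_comm => [|v vs]; last first.
  have [fg fh _] := H v a (sub v vs) aas; split=> // /gI e.
  by move: as_; rewrite -e ?vs //; apply: sub.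
rewrite rnChFr; last exact: gt.
rewrite IH //.
- by move=> u v us' vs; apply: gI; apply: sub.
- by move=> u v us' vs; apply: H; apply: sub.
move=> v vs; apply/frRn; split; first by right; apply/gt/sub.
by right=> e; have [_ _ /(_ (esym e))] := H v a (sub v vs) aas.
Qed.

Lemma rename_seq_front s1 s2 a f g t : uniq (s1 ++ a :: s2) ->
  {in s1 ++ a :: s2 &, injective f} ->
  {in s1 ++ a :: s2 &, forall u v, f u <> g v} ->
  rename_seq (s1 ++ a :: s2) f g t = rename_seq (s1 ++ s2) f g (ren t (g a) (f a)).
Proof.
rewrite cat_uniq => /and3P[_ /norP[as1 _] _] fI fg.
rewrite /rename_seq !foldl_cat /= -!/(rename_seq _ _ _ _).
have as_ : a \in s1 ++ a :: s2 by rewrite mem_cat mem_head orbT.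
rewrite rename_seq_comm // => v vs1.
have vs : v \in s1 ++ a :: s2 by rewrite mem_cat vs1.
split; [exact/nesym/fg|move=> /fI e|exact: fg].
by move: as1; rewrite -e ?vs1.
Qed.

(** Renamings with distinct sources, none of which is a target, commute by [RnCm], so the list
    matters only as a set. *)
Lemma rename_seq_perm s1 s2 f g t : uniq s1 -> perm_eq s1 s2 ->
  {in s2 &, injective f} -> {in s2 &, forall u v, f u <> g v} ->
  rename_seq s1 f g t = rename_seq s2 f g t.
Proof.
elim: s1 s2 t => [|a s1 IH] s2 t us1 p12.
  by move: p12; rewrite perm_sym => /perm_nilP ->.
have us2 : uniq s2 by rewrite -(perm_uniq p12).
have as2 : a \in s2 by rewrite -(perm_mem p12) mem_head.
case/splitPr: as2 us2 p12 => s2l s2r us2 p12 fI fg.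
have sub v : v \in s2l ++ s2r -> v \in s2l ++ a :: s2r.
  by rewrite !mem_cat inE => /orP[] ->; rewrite ?orbT.
rewrite rename_seq_front //; apply: IH.
- by case/andP: us1.
- by rewrite -(perm_cons a) (perm_trans p12) // perm_catC /= perm_cons perm_catC.
- by move=> u v us vs; apply: fI; apply: sub.
- by move=> u v us vs; apply: fg; apply: sub.
Qed.

Definition fresh_family s w t := [/\ {in s &, injective w},
  {in s &, forall u v, w u <> v} & {in s, forall v, fr (w v) t}].

Lemma ex_fresh_family s t (X : set Var) : countable X ->
  exists2 w, fresh_family s w t & {in s, forall v, ~ X (w v)}.
Proof.
move=> cX; pose Y := X `|` [set x | ~ fr x t] `|` [set x | x \in s].
have cY : countable Y.
  by apply: countableU (countable_seq s); apply: countableU cX (frSup t).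
have [w [wI wY]] : exists w : Var -> Var,
    {in s &, injective w} /\ {in s, forall v, ~ Y (w v)}.
  elim: s {Y} (Y) cY => [|a s IH] Y cY; first by exists id.
  have [z Yz] := uncountable_avoid uncVar cY.
  have [w [wI wY]] := IH (Y `|` [set z]) (countableU cY (countable1 z)).
  exists (fun v => if v == a then z else w v); split.
    move=> u v; rewrite !inE; case: eqVneq => [->|_] /=.
      move=> _; case: eqVneq => [->//|_] /= vs e.
      by case: (wY v vs); right; rewrite /= e.
    move=> us; case: eqVneq => [-> _ e|_ /= vs].
      by case: (wY u us); right; rewrite /= e.
    exact: wI.
  move=> v; rewrite inE; case: eqVneq => //= _ /wY; apply: contra_not => ?.
  by left.
exists w; last by move=> v /wY; apply: contra_not => ?; left; left.
split=> // [u v us vs e|v /wY vY].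
  by apply: (wY u us); right; rewrite /= e.
by apply: contrapT => ?; apply: vY; left; right.
Qed.

(** Renaming [v] to [r v] directly could merge it with a variable still present; parking all of [s]
    in fresh variables first prevents this. *)
Definition rename_via s w r t := rename_seq s w r (rename_seq s id w t).

Definition supported s r := forall v, r v <> v -> v \in s.

Lemma supported_mem s r v : supported s r -> v \in s -> r v \in s.
Proof.
move=> sr vs; have [->//|/eqP rv] := eqVneq (r v) v.
by apply: sr => /perm_inj.
Qed.

Lemma supported_perm_eq s r : uniq s -> supported s r ->
  perm_eq [seq r v | v <- s] s.
Proof.
move=> us sr; have urs : uniq [seq r v | v <- s].
  by rewrite map_inj_uniq //; apply: perm_inj.
have rs : {subset [seq r v | v <- s] <= s}.
  by move=> _ /mapP[v vs ->]; apply: supported_mem.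
by apply: uniq_perm => //; have [] := uniq_min_size urs rs; rewrite ?size_map.
Qed.

(** For disjoint families the first passage to [w2] can itself be routed through [w1]; then [w2] is
    an intermediate that telescopes away. Overlapping families are compared with a third one
    disjoint from both. *)
Lemma rename_via_indep s r w1 w2 t : uniq s -> supported s r ->
  fresh_family s w1 t -> fresh_family s w2 t ->
  rename_via s w1 r t = rename_via s w2 r t.
Proof.
wlog dis : w1 w2 / {in s &, forall u v, w1 u <> w2 v}.
  move=> H us sr w1t w2t.
  have [w3 w3t w3d] := @ex_fresh_family s t
    ([set x | x \in map w1 s] `|` [set x | x \in map w2 s])
    (countableU (countable_seq _) (countable_seq _)).
  rewrite (H w1 w3) ?(H w2 w3) // => u v us' vs e; apply: (w3d v vs).
    by right; rewrite /= -e map_f.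
  by left; rewrite /= -e map_f.
move=> us sr [w1I w1s w1t] [w2I w2s w2t]; rewrite /rename_via.
rewrite -[in RHS](@rename_seq_chain s id w1 w2 t) //; last first.
  by move=> u v us' vs; split; [apply/nesym/w1s|apply/nesym/w2s|apply: dis].
rewrite (@rename_seq_chain s w1 w2 r) //.
  move=> u v us' vs; split; [exact: dis|apply: w1s|apply: w2s] => //;
  exact: supported_mem.
move=> v vs; apply: fr_rename_seq => [u us'|]; first exact: dis.
by left; apply: w2t.
Qed.

Lemma rename_via_cons s a w r t : uniq (a :: s) -> supported s r ->
  fresh_family (a :: s) w t -> rename_via (a :: s) w r t = rename_via s w r t.
Proof.
move=> /= /andP[as_ us] sr [wI ws wt].
have sub v : v \in s -> v \in a :: s by rewrite inE orbC => ->.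
have aas := mem_head a s.
have ra : r a = a by apply: contrapT => /sr; rewrite (negPf as_).
rewrite /rename_via /rename_seq /= -!/(rename_seq _ _ _ _) ra.
rewrite rename_seq_comm => [|v vs]; last first.
  split; [|exact/nesym/ws/sub|]; last by move=> e; move: as_; rewrite -e vs.
  by move=> /wI e; move: as_; rewrite -e ?vs //; apply: sub.
by rewrite rnChFr ?rnId //; apply: wt.
Qed.

Lemma fresh_family_sub s s' w t : {subset s' <= s} ->
  fresh_family s w t -> fresh_family s' w t.
Proof.
move=> ss [wI ws wt]; split=> [u v /ss us /ss vs|u v /ss us /ss vs|v /ss].
- exact: wI.
- exact: ws.
- exact: wt.
Qed.

Lemma rename_via_perm s1 s2 w r t : uniq s1 -> perm_eq s1 s2 ->
  supported s1 r -> fresh_family s1 w t ->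
  rename_via s1 w r t = rename_via s2 w r t.
Proof.
move=> us1 p12 sr w1; have ms := perm_mem p12.
have [wI ws wt] : fresh_family s2 w t.
  by apply: fresh_family_sub w1 => v; rewrite ms.
rewrite /rename_via (rename_seq_perm _ us1 p12) //; last first.
  move=> u v us vs; apply: ws => //; rewrite -ms; apply: supported_mem => //.
  by rewrite ms.
congr rename_seq; apply: rename_seq_perm => // u v us vs; exact/nesym/ws.
Qed.

Lemma ex_support r : exists2 s, uniq s & forall v, v \in s <-> r v <> v.
Proof.
have [s rs] := (finite_seqP _).1 (perm_fin r).
exists (undup s) => [|v]; first exact: undup_uniq.
rewrite mem_undup; have <- : [set x | r x <> x] v = (v \in s) by rewrite rs.
by [].
Qed.

(** Independence of the list and of the fresh family lets later proofs choose both to suit several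
    elements at once. *)
Lemma ex_rename_via t r : exists u, forall s w, uniq s -> supported s r ->
  fresh_family s w t -> rename_via s w r t = u.
Proof.
have [s0 us0 s0r] := ex_support r.
have s0supp : supported s0 r by move=> v /s0r.
have [w0 w0t _] := ex_fresh_family s0 t (@countable0 _).
exists (rename_via s0 w0 r t) => s w us sr wt.
have s0s : {subset s0 <= s} by move=> v /s0r /sr.
rewrite (rename_via_indep us0 s0supp w0t (fresh_family_sub s0s wt)).
(* Entries of [s] outside the exact support [s0] are fixed by [r]; they are moved to the front and
   dropped one by one. *)
pose e := [seq v <- s | v \notin s0].
have pe : perm_eq s (e ++ s0).
  rewrite perm_sym -(permPr (permEl (perm_filterC [in s0] s))) perm_catC perm_cat2r.
  apply: uniq_perm => // [|v]; first exact: filter_uniq.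
  by rewrite mem_filter /=; case: (boolP (v \in s0)) => //= /s0s ->.
rewrite (rename_via_perm us pe sr wt).
have {wt} wt : fresh_family (e ++ s0) w t.
  by apply: fresh_family_sub wt => v; rewrite (perm_mem pe).
have {us sr} us : uniq (e ++ s0) by rewrite -(perm_uniq pe).
elim: e us wt {pe} => //= a e IH ue wt; rewrite rename_via_cons //.
- apply: IH; first by case/andP: ue.
  by apply: fresh_family_sub wt => v; rewrite inE orbC => ->.
- by move=> v /s0supp; rewrite mem_cat orbC => ->.
Qed.

Definition perm_of_ren t r : M := sval (cid (ex_rename_via t r)).

Lemma perm_of_renE s w t r : uniq s -> supported s r -> fresh_family s w t ->
  perm_of_ren t r = rename_via s w r t.
Proof. by move=> us sr wt; rewrite /perm_of_ren; case: cid => u /= ->. Qed.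

Lemma perm_of_ren_id : PmId perm_of_ren.
Proof. by move=> t; rewrite (@perm_of_renE [::] id). Qed.

(** With the second permutation reindexed along [r], the four passes lead from [id] to [w1], to [r],
    to [w2 \o r], to [q \o r]; two telescopings leave [id] to [w1] to [q \o r]. *)
Lemma perm_of_ren_comp : PmCp perm_of_ren.
Proof.
move=> t r q; have [sr usr srE] := ex_support r; have [sq usq sqE] := ex_support q.
pose s := undup (sr ++ sq); have us : uniq s by apply: undup_uniq.
have rs : supported s r by move=> v /srE; rewrite mem_undup mem_cat => ->.
have qs : supported s q.
  by move=> v /sqE; rewrite mem_undup mem_cat orbC => ->.
have qrs : supported s (perm_comp q r).
  move=> v /=; have [->|/eqP rv _] := eqVneq (r v) v; first exact: qs.
  exact: rs.
have [w1 w1t _] := ex_fresh_family s t (@countable0 _).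
rewrite (perm_of_renE us rs w1t).
have [w2 w2t w2d] := ex_fresh_family s (rename_via s w1 r t)
  (countableU (countable_seq (map w1 s)) (frSup t)).
have w12 : {in s &, forall u v, w1 u <> w2 v}.
  by move=> u v us' vs e; apply: (w2d v vs); left; rewrite /= -e map_f.
have w2t' : {in s, forall v, fr (w2 v) t}.
  by move=> v vs; apply: contrapT => ?; apply: (w2d v vs); right.
have [w1I w1s w1f] := w1t; have [w2I w2s w2f] := w2t.
have rS v : v \in s -> r v \in s by apply: supported_mem.
have qS v : v \in s -> q v \in s by apply: supported_mem.
rewrite (perm_of_renE us qs w2t) (perm_of_renE us qrs w1t) /rename_via.
have pr := supported_perm_eq us rs.
have urs : uniq [seq r v | v <- s] by rewrite (perm_uniq pr).
rewrite -(@rename_seq_perm _ _ id w2 _ urs pr) //; last first.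
  by move=> u v us' vs; apply/nesym/w2s.
rewrite rename_seq_comp (@rename_seq_chain s w1 r (w2 \o r)) //.
- rewrite -(@rename_seq_perm _ _ w2 q _ urs pr) //; last first.
    by move=> u v us' vs; apply: w2s => //; apply: qS.
  rewrite rename_seq_comp (@rename_seq_chain s w1 (w2 \o r) (q \o r)) //.
  + by move=> u v us' vs /w2I e; apply: (@perm_inj _ r); apply: e; apply: rS.
  + move=> u v us' vs /=; split.
    * by apply: w12 => //; apply: rS.
    * by apply: w1s => //; apply/qS/rS.
    * by apply: w2s; rewrite ?rS ?qS // rS.
  + move=> v vs; apply: fr_rename_seq => [u us'|]; first by apply: w12; rewrite ?rS.
    by left; apply/w2t'/rS.
- by move=> u v _ _ /perm_inj.
- move=> u v us' vs /=; split.
  + by apply: w1s => //; apply: rS.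
  + by apply: w12 => //; apply: rS.
  + by apply/nesym/w2s; rewrite rS.
- move=> v vs; apply: fr_rename_seq => [u us'|]; first by apply: w1s; rewrite ?rS.
  by right; exists (r v) => //; apply: rS.
Qed.

(** Since [y] is fresh, both renamings indexed by [y] are idle; [x] goes through [w x] to [y], which
    [RnChFr] shortens. *)
Lemma perm_of_ren_transp t x y : fr y t ->
  perm_of_ren t (transp y x) = ren t y x.
Proof.
move=> yt; have [<-|/eqP yx] := eqVneq y x.
  by rewrite rnId transpvv perm_of_ren_id.
have us : uniq [:: y; x] by rewrite /= inE andbT; apply/eqP.
have sr : supported [:: y; x] (transp y x).
  by move=> v /= sv; rewrite !inE; apply: contrapT => /negP/norP[/eqP vy /eqP vx];
     apply: sv; rewrite swapv_id.
have [w wt _] := ex_fresh_family [:: y; x] t (@countable0 _).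
rewrite (perm_of_renE us sr wt); have [wI ws wf] := wt.
have [y_ x_] : y \in [:: y; x] /\ x \in [:: y; x] by rewrite !inE !eqxx orbT.
rewrite /rename_via /rename_seq /= swapvL swapvR (rnFr _ yt).
rewrite (rnFr (t := ren t (w x) x)); last first.
  apply/frRn; split; first by right; apply: wf.
  by right=> /wI-/(_ x_ y_) /nesym.
by rewrite rnChFr //; apply: wf.
Qed.

Lemma fr_iff_perm_of_ren t x :
  fr x t <-> countable [set y | perm_of_ren t (transp x y) <> t].
Proof.
split=> [xt|].
  apply: countable_subset (frSup t) => y /= ny yt; apply: ny.
  by rewrite transpC perm_of_ren_transp // rnFr.
move=> cY; have [y /not_orP[/not_orP[xy yt] yx]] := uncountable_avoid uncVar
  (countableU (countableU cY (frSup t)) (countable1 x)).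
move: xy yt => /contrapT + /contrapT yt; rewrite transpC perm_of_ren_transp // => <-.
by apply/frRn; split; [left|right].
Qed.

(** Freshness is expressed by the countability criterion, and conjugation shows that the image under
    [r] of the exceptional set for [x] covers the one for [r x]. *)
Lemma fr_perm_of_ren t x r : fr x t -> fr (r x) (perm_of_ren t r).
Proof.
move=> /fr_iff_perm_of_ren/(countable_image r) xt; apply/fr_iff_perm_of_ren.
apply: countable_subset xt => z /= nz; have [q [rK qK]] := perm_inverse r.
exists (q z); last exact: qK.
move=> e; apply: nz; rewrite -[in RHS]e !perm_of_ren_comp.
congr perm_of_ren; apply: eq_perm => v /=.
by rewrite (swapv_morph _ _ _ (@perm_inj _ r)) qK.
Qed.

(** * Compatibility of the derived permutations with the destructor *)

Section Destructor.
Variable dest : M -> Defs.shape Var M.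

Lemma dest_rename_seq_Vr_id s f g t x : RnVr dest ren ->
  {in s, forall v, f v <> x} -> dest t = V M x ->
  dest (rename_seq s f g t) = V M x.
Proof.
move=> rnVr; rewrite /rename_seq; elim: s t => //= a s IH t fx /rnVr tx.
apply: IH => [v vs|]; first by apply: fx; rewrite inE vs orbT.
by rewrite tx renv_id //; apply/nesym/fx/mem_head.
Qed.

Lemma dest_rename_seq_Vr s f g t x : RnVr dest ren -> uniq s ->
  {in s &, injective f} -> {in s &, forall u v, f u <> g v} -> x \in s ->
  dest t = V M (f x) -> dest (rename_seq s f g t) = V M (g x).
Proof.
move=> rnVr; elim: s t => //= a s IH t /andP[as_ us] fI fg.
have sub v : v \in s -> v \in a :: s by rewrite inE orbC => ->.
rewrite inE /rename_seq /= -/(rename_seq _ _ _ _).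
case: eqVneq => [->|xa] /= xs /rnVr tx; last first.
  apply: IH => // [u v us' vs|u v us' vs|].
  - by apply: fI; apply: sub.
  - by apply: fg; apply: sub.
  - rewrite tx renv_id // => /fI e; move: xa; rewrite e ?eqxx ?mem_head //.
    exact: sub.
apply: dest_rename_seq_Vr_id => //; last by rewrite tx renvL.
by move=> v vs; apply: fg; rewrite ?mem_head ?sub.
Qed.

Lemma perm_of_ren_Vr : RnVr dest ren -> FrVrD dest fr -> PmVr dest perm_of_ren.
Proof.
move=> rnVr frVr t x r tx; have [s us sE] := ex_support r.
have sr : supported s r by move=> v /sE.
have [w wt _] := ex_fresh_family s t (@countable0 _).
rewrite (perm_of_renE us sr wt) /rename_via; have [wI ws wf] := wt.
have [xs|xs] := boolP (x \in s).
  apply: dest_rename_seq_Vr => //.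
    by move=> u v us' vs; apply: ws => //; apply: supported_mem.
  by apply: dest_rename_seq_Vr => // u v us' vs; apply/nesym/ws.
have -> : r x = x by apply: contrapT => /sr; rewrite (negPf xs).
apply: dest_rename_seq_Vr_id => // [v vs|]; first exact: frVr tx (wf v vs).
by apply: dest_rename_seq_Vr_id => // v vs e; move: xs; rewrite -e vs.
Qed.

Lemma dest_rename_seq_Ap s f g t t1 t2 : RnAp dest ren -> dest t = A _ t1 t2 ->
  dest (rename_seq s f g t) = A _ (rename_seq s f g t1) (rename_seq s f g t2).
Proof.
move=> rnAp; rewrite /rename_seq.
by elim: s t t1 t2 => //= a s IH t t1 t2 /rnAp tA; apply: IH.
Qed.

Lemma perm_of_ren_Ap : RnAp dest ren -> FrApD dest fr -> PmAp dest perm_of_ren.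
Proof.
move=> rnAp frAp t t1 t2 r tA; have [s us sE] := ex_support r.
have sr : supported s r by move=> v /sE.
have [w wt _] := ex_fresh_family s t (@countable0 _); have [wI ws wf] := wt.
rewrite !(@perm_of_renE s w) //.
- by do 2!apply: dest_rename_seq_Ap => //.
- by split=> // v /wf /(frAp _ _ _ _ tA)[].
- by split=> // v /wf /(frAp _ _ _ _ tA)[].
Qed.

Lemma dest_rename_seq_Lm s f g t K : RnLm1 dest ren -> dest t = L K ->
  exists K', dest (rename_seq s f g t) = L K' /\ forall x t',
    {in s, forall v, f v <> x /\ g v <> x} -> sval K (x, t') ->
    sval K' (x, rename_seq s f g t').
Proof.
move=> rnLm; rewrite /rename_seq; elim: s t K => [|a s IH] t K /=.
  by move=> tK; exists K.
move=> /rnLm-/(_ (g a) (f a))[K1 [/IH[K' [tK' KK']] KK1]]; exists K'.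
split=> // x t' fgx xK; have [fx gx] := fgx a (mem_head a s).
apply: KK' => [v vs|]; first by apply: fgx; rewrite inE vs orbT.
by apply: KK1 => //; apply: nesym.
Qed.

(* A binding variable moved by the permutation is first renamed to a fixed one. *)
Lemma perm_of_ren_Lm : RnLm1 dest ren -> RnBvr' dest ren fr ->
  PmLm dest perm_of_ren.
Proof.
move=> rnLm rnBvr' t K r tK; have [s us sE] := ex_support r.
have sr : supported s r by move=> v /sE.
have rfix v : v \notin s -> r v = v.
  by move=> vs; apply: contrapT => /sr; rewrite (negPf vs).
have via_Lm w : fresh_family s w t ->
    exists K', dest (perm_of_ren t r) = L K' /\ forall x t', x \notin s ->
      {in s, forall v, w v <> x} -> sval K (x, t') ->
      sval K' (x, rename_via s w r t').
  move=> wt; rewrite (perm_of_renE us sr wt) /rename_via.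
  have [K1 [t1 KK1]] := dest_rename_seq_Lm s id w rnLm tK.
  have [K' [tK' KK']] := dest_rename_seq_Lm s w r rnLm t1.
  exists K'; split=> // x t' xs wx xK.
  apply: KK' => [v vs|]; first split; [exact: wx| |apply: KK1 => // v vs; split].
  - by move=> e; move: xs; rewrite -e supported_mem.
  - by move=> e; move: xs; rewrite -e vs.
  - exact: wx.
have [w0 w0t _] := ex_fresh_family s t (@countable0 _).
have [K' [tK' _]] := via_Lm _ w0t; exists K'; split=> // x t' xK.
(* The set [K'] does not depend on the fresh family, so the family may be chosen fresh for the given
   body [u] and away from [y]. *)
have unmoved y u : y \notin s -> sval K (y, u) -> sval K' (y, perm_of_ren u r).
  move=> ys yK; have [w wt wX] := ex_fresh_family s t
    (countableU (countable1 y) (frSup u)).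
  have [K1 [tK1 KK1]] := via_Lm _ wt.
  have <- : K1 = K' by move: tK'; rewrite tK1 => -[].
  have wu : fresh_family s w u.
    have [wI ws wf] := wt; split=> // v vs; apply: contrapT => ?.
    by apply: (wX v vs); right.
  rewrite (perm_of_renE us sr wu); apply: KK1 => // v vs e.
  by apply: (wX v vs); left.
have [xs|xs] := boolP (x \in s); last by rewrite rfix //; apply: unmoved.
(* The binder [x] is renamed to a [y] outside the support, [unmoved] applies, and [y] is renamed to
   [r x]; the three permutations of the body compose to [r]. *)
have [y /not_orP[/contrapT yt' /negP ys]] := uncountable_avoid uncVar
  (countableU (frSup t') (countable_seq s)).
have := unmoved _ _ ys (rnBvr' _ _ _ _ _ tK xK yt').
rewrite -perm_of_ren_transp // => yK.
have rxu : fr (r x) (perm_of_ren (perm_of_ren t' (transp y x)) r).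
  apply: fr_perm_of_ren; rewrite -{1}(swapvL y x).
  exact: (fr_perm_of_ren (transp y x)).
have := rnBvr' _ _ _ _ _ tK' yK rxu.
rewrite -perm_of_ren_transp // !perm_of_ren_comp.
rewrite (_ : perm_comp _ _ = r) //; apply: eq_perm => v /=.
rewrite (swapv_morph _ _ _ (@perm_inj _ r)) (rfix y) //.
by rewrite (swapvC y) swapvK.
Qed.

Lemma perm_of_ren_Bvr (fv : M -> set Var) : (forall t x, fv t x <-> ~ fr x t) ->
  RnBvr dest ren fr -> PmBvr dest perm_of_ren fv.
Proof.
move=> fvE rnBvr s K x t x' t' sK xK x'K.
have [x't ->] := rnBvr _ _ _ _ _ _ sK xK x'K; split.
  by case: x't => [->|x't]; [left|right; rewrite fvE].
case: x't => [->|x't]; last by rewrite perm_of_ren_transp.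
by rewrite transpvv perm_of_ren_id rnId.
Qed.

End Destructor.

End RenamingAction.

(** * Conversions between models *)

Section Models.
Variables (Var : eqType) (M : Type) (dest : M -> Defs.shape Var M).

(** [Sigma i1] and [Sigma i2] are convertible, as are [Sigma i5] and [Sigma i6], and [Sigma i8] and
    [Sigma i9]; the five models built below thus serve all eight indices. *)
Definition absent (T : Type) (h : false) : T := False_rect T (not_false_is_true h).

Definition pm_fv_model (pm : M -> perm Var -> M) (fv : M -> set Var) :
    model Var (Sigma i1) :=
  @Model Var (Sigma i1) M (fun s =>
    match s return Sigma i1 s -> interp Var s M with
    | s_dest => fun=> dest | s_pm => fun=> pm | s_fv => fun=> fv
    | s_vr | s_sw | s_sb | s_ren | s_fr => @absent _
    end).

Definition sw_fv_model (sw : M -> Var -> Var -> M) (fv : M -> set Var) :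
    model Var (Sigma i3) :=
  @Model Var (Sigma i3) M (fun s =>
    match s return Sigma i3 s -> interp Var s M with
    | s_dest => fun=> dest | s_sw => fun=> sw | s_fv => fun=> fv
    | s_vr | s_pm | s_sb | s_ren | s_fr => @absent _
    end).

Definition sw_fr_model (sw : M -> Var -> Var -> M) (fr : Var -> M -> Prop) :
    model Var (Sigma i5) :=
  @Model Var (Sigma i5) M (fun s =>
    match s return Sigma i5 s -> interp Var s M with
    | s_dest => fun=> dest | s_sw => fun=> sw | s_fr => fun=> fr
    | s_vr | s_pm | s_sb | s_ren | s_fv => @absent _
    end).

Definition ren_fr_model (ren : M -> Var -> Var -> M) (fr : Var -> M -> Prop) :
    model Var (Sigma i8) :=
  @Model Var (Sigma i8) M (fun s =>
    match s return Sigma i8 s -> interp Var s M with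
    | s_dest => fun=> dest | s_ren => fun=> ren | s_fr => fun=> fr
    | s_vr | s_pm | s_sb | s_sw | s_fv => @absent _
    end).

Definition sb_fr_model (vr : Var -> M) (sb : M -> M -> Var -> M)
    (fr : Var -> M -> Prop) : model Var (Sigma i7) :=
  @Model Var (Sigma i7) M (fun s =>
    match s return Sigma i7 s -> interp Var s M with
    | s_dest => fun=> dest | s_vr => fun=> vr | s_sb => fun=> sb
    | s_fr => fun=> fr | s_pm | s_ren | s_sw | s_fv => @absent _
    end).

End Models.

Section Conversions.
Variables (Var : eqType) (uncVar : ~ countable [set: Var]).
Variables (M : Type) (dest : M -> Defs.shape Var M).
Implicit Types (pm : M -> perm Var -> M) (sw ren : M -> Var -> Var -> M).
Implicit Types (fv : M -> set Var) (fr : Var -> M -> Prop) (x y z : Var).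

Lemma swap_of_perm pm :
  PmVr dest pm -> PmAp dest pm -> PmLm dest pm -> PmId pm -> PmCp pm ->
  let sw t x y := pm t (transp x y) in
  [/\ SwVr dest sw, SwAp dest sw & SwLm dest sw] /\
  [/\ SwId sw, SwIv sw & SwCp sw].
Proof.
move=> pmVr pmAp pmLm pmId pmCp sw; split; split.
- by move=> t x z1 z2; apply: pmVr.
- by move=> t t1 t2 z1 z2; apply: pmAp.
- by move=> t K z1 z2; apply: pmLm.
- by move=> t z; rewrite /sw transpvv.
- move=> t x y; rewrite /sw pmCp -[RHS]pmId; congr pm.
  by apply: eq_perm => v; apply: swapvK.
- move=> t x y z1 z2; rewrite /sw !pmCp; congr pm.
  by apply: eq_perm => v /=; rewrite -swapv_morph //; apply: swapv_inj.
Qed.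

Lemma Props3_of_Props1 pm fv : Props1 (pm_fv_model dest pm fv) ->
  Props3 (sw_fv_model dest (fun t x y => pm t (transp x y)) fv).
Proof.
rewrite /Props1 /Props3 /= => -[[pmVr pmAp pmLm] [pmId pmCp fvD pmBvr]].
by have [h1 h2] := swap_of_perm pmVr pmAp pmLm pmId pmCp.
Qed.

Lemma Props1_of_Props3 sw fv : Props3 (sw_fv_model dest sw fv) ->
  exists pm, Props1 (pm_fv_model dest pm fv).
Proof.
rewrite /Props3 /Props1 /= => -[[swVr swAp swLm] [[swId swIv swCp] [fvD swBvr]]].
have [pm [pmId pmCp pmE _ pmD]] := perm_of_swap swId swIv swCp.
exists pm; split; first exact: pmD; split=> //.
- move=> t /=; have pmE' x :
      [set y | pm t (transp x y) <> t] = [set y | sw t x y <> t].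
    by apply/seteqP; split=> y /=; rewrite pmE.
  by rewrite fvD; apply/seteqP; split=> x /=; rewrite pmE'.
- by move=> s K x t x' t' sK xK x'K /=; rewrite pmE; apply: swBvr sK xK x'K.
Qed.

Lemma Props5_of_Props2 pm fv : Props2 (pm_fv_model dest pm fv) ->
  Props5 (sw_fr_model dest (fun t x y => pm t (transp x y)) (fun x t => ~ fv t x)).
Proof.
rewrite /Props2 /Props5 /= => -[[pmVr pmAp pmLm]].
move=> [[pmId pmCp pmFv pmBvr] [fvVr fvAp fvLm]].
have [h1 h2] := swap_of_perm pmVr pmAp pmLm pmId pmCp.
do 3!(split=> //); first split.
- move=> t x y xt yt; apply: pmFv; apply/seteqP; split=> // v [/= sv vt].
  by apply: sv; apply: swapv_id => e; [apply: xt|apply: yt]; rewrite -e.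
- exact: pmBvr.
split.
- by move=> t x z /fvVr tx tz e; apply: tz; rewrite e.
- by move=> t t1 t2 z /fvAp h zt; split=> zi; apply/zt/h; [left|right].
- move=> t K x t' z tK xK zt; have [->|/eqP zx] := eqVneq z x; first by left.
  by right=> zt'; apply: zt; apply: (fvLm _ _ _ _ tK xK); split.
Qed.

Lemma Props2_of_Props5 sw fr : Props5 (sw_fr_model dest sw fr) ->
  exists pm, Props2 (pm_fv_model dest pm (fun t => [set x | ~ fr x t])).
Proof.
rewrite /Props5 /Props2 /= => -[[swVr swAp swLm]].
move=> [[swId swIv swCp] [[swFr swBvr] [frVr frAp frLm]]].
have [pm [pmId pmCp pmE pmFix pmD]] := perm_of_swap swId swIv swCp.
exists pm; split; first exact: pmD; split; split=> //.
- move=> t r rt; apply: pmFix => x y rx ry; apply: swFr; apply: contrapT => nt.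
    by have : (set0 : set Var) x by rewrite -rt.
  by have : (set0 : set Var) y by rewrite -rt.
- move=> s K x t x' t' sK xK x'K /=; rewrite pmE.
  have [h ->] := swBvr _ _ _ _ _ _ sK xK x'K; split=> //.
  by case: h; [left|right].
- by move=> t x tx /(frVr _ _ _ tx).
- by move=> t t1 t2 tA x [] /= nx /(frAp _ _ _ _ tA)[].
- by move=> t K x t' tK xK z [/= zt' zx] /(frLm _ _ _ _ _ tK xK)[].
Qed.

(** Under [FvDSw] a fresh variable is one whose swaps with all but countably many others are idle,
    and the laws of freshness are drawn from such idle swaps. [fr] is left abstract to cover both
    [ifresh] and the complement of an arbitrary [fv]. *)
Lemma Props6_of_Props3 sw fv fr : (forall t x, fv t x <-> ~ fr x t) ->
  Props3 (sw_fv_model dest sw fv) -> Props6 (sw_fr_model dest sw fr).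
Proof.
rewrite /Props3 /Props6 /= => fvE [[swVr swAp swLm] [[swId swIv swCp] [fvD swBvr]]].
have frE x t : fr x t <-> countable [set y | sw t x y <> t].
  have -> : fr x t <-> ~ fv t x by rewrite fvE; split=> [?|/contrapT].
  by rewrite fvD /=; split=> [/contrapT//|ct nct]; apply: nct.
have swBvr' s K x t x' t' : dest s = L K -> sval K (x, t) -> sval K (x', t') ->
    (x' = x \/ fr x' t) /\ t' = sw t x' x.
  move=> sK xK x'K; have [h ->] := swBvr _ _ _ _ _ _ sK xK x'K.
  by split=> //; case: h => [|h]; [left|right; apply: contrapT; rewrite -fvE].
have frSw1 t x y z : fr z t -> fr (swapv x y z) (sw t x y).
  move=> /frE/(countable_image (swapv x y)) zt; apply/frE.
  apply: countable_subset zt => v /= nv; exists (swapv x y v); last exact: swapvK.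
  by move=> e; apply: nv; rewrite -[in RHS]e [in RHS]swCp swapvK.
split=> //; split=> //; split; split.
- move=> t x y /frE xt /frE yt.
  (* The swaps of [z] with [x] and with [y] are both idle, and the swap of [x] and [y] is a
     conjugate of one by the other. *)
  have [z /not_orP[/not_orP[/not_orP[xz yz] zx] zy]] := uncountable_avoid uncVar
    (countableU (countableU (countableU xt yt) (countable1 x)) (countable1 y)).
  move: xz yz zx zy => /= /contrapT xz /contrapT yz /nesym zx /nesym zy.
  have [->|/eqP/nesym xy] := eqVneq x y; first exact: swId.
  rewrite -[LHS](swIv _ x z) [sw (sw t x y) x z]swCp xz swapvL swapv_id //.
  by rewrite (sw_sym swIv swCp t z y) yz xz.
- move=> t x y z; split=> [/(@frSw1 _ x y)|/(@frSw1 _ x y)].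
    by rewrite swIv.
  by rewrite swapvK.
- move=> t K x1 t1 x2 t2 tK h1 h2; exists x2.
  have [x21 ->] := swBvr' _ _ _ _ _ _ tK h1 h2; split=> //.
  by left.
- move=> t x z tx /frE zt e; move: zt; rewrite e => /countableU/(_ (countable1 x)).
  move=> /(uncountable_avoid uncVar)[v /not_orP[/= /contrapT tv vx]].
  by have := swVr _ _ x v tx; rewrite tv tx swapvL => -[/esym].
- move=> t t1 t2 z tA /frE zt; split; apply/frE; apply: countable_subset zt.
    by move=> v /= + tv; have := swAp _ _ _ z v tA; rewrite tv tA => -[<- _].
  by move=> v /= + tv; have := swAp _ _ _ z v tA; rewrite tv tA => -[_ <-].
- move=> t K x t' z tK xK /frE zt; have [|/eqP/nesym zx] := eqVneq z x; first by left.
  right; apply/frE; apply: countable_subset (countableU zt (countable1 x)) => v.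
  move=> /= nv; apply: contrapT => /not_orP[/= /contrapT tv /nesym vx].
  (* An idle swap of [z] and [v] maps [K] into itself and fixes the binder [x]; two bodies under the
     same binder are equal, so the swap is idle on [t'] as well. *)
  have [K' []] := swLm _ _ z v tK; rewrite tv tK => -[<-] /(_ _ _ xK).
  rewrite swapv_id // => /(swBvr' _ _ _ _ _ _ tK xK)[_].
  by rewrite swId.
Qed.

(** The witness [z] of [SwCg] gives [t'] as [t] swapped by [z] and [x], then by [z] and [x']; when
    [z] and [x'] are fresh for [t], [SwCp] and [SwFr] reduce this to one swap of [x'] and [x]. *)
Lemma Props5_of_Props6 sw fr : Props6 (sw_fr_model dest sw fr) ->
  Props5 (sw_fr_model dest sw fr).
Proof.
rewrite /Props6 /Props5 /= => -[[swVr swAp swLm]].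
move=> [[swId swIv swCp] [[swFr frSw swCg] h]].
split=> //; split=> //; split=> //; split=> // s K x t x' t' sK xK x'K.
have [z [zx zx' e]] := swCg _ _ _ _ _ _ sK xK x'K.
have -> : t' = sw (sw t z x) z x' by rewrite e swIv.
have [<-|/eqP xx'] := eqVneq x' x; first by rewrite swIv swId; split=> //; left.
have [zx0|/eqP nzx] := eqVneq z x.
  move: zx' e; rewrite zx0 swId => -[/esym//|xt'] e.
  split; last by rewrite (sw_sym swIv swCp).
  by right; rewrite e frSw swapvR.
case: zx => // zt.
have [nzx'|/eqP nzx'] := eqVneq z x'.
  by rewrite -nzx' swId; split=> //; right.
case: zx' => // zt'.
(* Freshness of [z] for [t'] is carried over to [x'] and [t] through the equation [e]. *)
have x't : fr x' t.
  rewrite -[t](swIv _ z x) e frSw swapv_id; [|exact/nesym|by []].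
  by rewrite frSw swapvR.
split; first by right.
by rewrite swCp (swFr _ _ _ zt x't) swapvL swapv_id //; apply: nesym.
Qed.

Lemma Props9_of_Props7 vr sb fr : Props7 (sb_fr_model dest vr sb fr) ->
  Props9 (ren_fr_model dest (fun t y z => sb t (vr y) z) fr).
Proof.
rewrite /Props7 /Props9 /= => -[[sbVr sbAp sbLm] [[sbId sbChFr sbCm sbFr frSb]]].
move=> [[sbBvr sbBvr'] [[frSup frVrD frApD frLmD] [vrInv frVr]]].
split; [split|split; [split|by do 2!split]].
- move=> t x y z tx; rewrite (sbVr _ _ _ _ tx) /renv; case: ifP => // _.
  exact/vrInv.
- by move=> t t1 t2 y z; apply: sbAp.
- move=> t K y z tK; have [K' [tK' KK']] := sbLm _ _ (vr y) z tK.
  by exists K'; split=> // x t' xK xy xz; apply: KK' => //; apply: frVr.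
- by move=> t z; apply: sbId.
- by move=> t x1 x2 x3; apply: sbChFr.
- move=> t x1 x2 y1 y2 x2y1 /nesym x1y1 x1y2.
  by apply: sbCm => //; apply: frVr => //; apply: nesym.
- by move=> t x y; apply: sbFr.
- move=> t x y z; rewrite frSb; suff -> : fr z (vr x) <-> x <> z by [].
  split=> [zx|/nesym]; last exact: frVr.
  by apply: nesym; apply: frVrD zx; apply/vrInv.
Qed.

Lemma Props8_of_Props9 ren fr : Props9 (ren_fr_model dest ren fr) ->
  Props8 (ren_fr_model dest ren fr).
Proof.
rewrite /Props9 /Props8 /= => -[h1 [[rnId rnChFr rnCm rnFr frRn] [[rnBvr rnBvr']]]].
move=> [frSup frVr frAp frLm].
have fr_ren t x y : x <> y -> fr y (ren t x y).
  by move=> xy; apply/frRn; split; [left|right].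
split=> //; split; [split=> //|split; [split=> //|split=> //]].
- by move=> t x1 x2 y xy; apply/rnFr/fr_ren.
- by move=> t y x1 x2 x3 yx; apply/rnChFr/fr_ren.
- move=> t x; split=> [xt|].
    by apply: countable_subset (@countable0 _) => y /=; apply; apply: rnFr.
  move=> /countableU/(_ (countable1 x)) /(uncountable_avoid uncVar)[y].
  by move=> /not_orP[/= /contrapT <- yx]; apply: fr_ren.
- move=> t x y z; rewrite /renv; case: eqVneq => [->|/eqP zy] /frRn[].
    by move=> _ [].
  by case.
Qed.

(** [RnIm] and [RnCh] speak of elements already renamed. By [FrDRn], an element [t] with [x] fresh
    equals [ren t y x] for some [y] different from [x], which turns them into [RnFr] and
    [RnChFr]. *)
Lemma Props9_of_Props8 ren fr : Props8 (ren_fr_model dest ren fr) ->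
  Props9 (ren_fr_model dest ren fr).
Proof.
rewrite /Props8 /Props9 /= => -[[rnVr rnAp rnLm] [[rnId rnIm rnCh rnCm]]].
move=> [[frRnD rnBvr rnBvr'] [frSup frRn2]].
have unused t x (X : set Var) : countable X -> fr x t ->
    exists y, [/\ ren t y x = t, y <> x & ~ X y].
  move=> cX /frRnD/countableU/(_ (countableU (countable1 x) cX)).
  move=> /(uncountable_avoid uncVar)[y /not_orP[/= /contrapT ty /not_orP[yx Xy]]].
  by exists y.
have rnFr : RnFr ren fr.
  move=> t x y yt; have [w [tw wy _]] := unused _ _ _ (@countable0 _) yt.
  by rewrite -tw rnIm.
have fr_ren u a b : a <> b -> fr b (ren u a b).
  move=> ab; apply/frRnD; apply: countable_subset (@countable0 _) => v /=.
  by apply; apply: rnIm.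
split=> //; split; [split=> //|split; [by []|split=> //]].
- move=> t x1 x2 x3 x2t; have [y [ty yx _]] := unused _ _ _ (@countable0 _) x2t.
  by rewrite -ty rnCh.
- move=> t x y z; split=> [zt|[zt yt]].
    split.
      have [|/eqP zy] := eqVneq z y; first by left.
      by right; apply: (frRn2 _ x y); rewrite renv_id.
    have [xz|] := eqVneq x z; last by move=> /eqP; right.
    by left; apply: (frRn2 _ x y); rewrite renvL {1}xz.
  case: yt => [yt|xz].
    by rewrite rnFr //; case: zt => // ->.
  have [zy|/eqP zy] := eqVneq z y.
    by rewrite zy; apply: fr_ren; rewrite -zy.
  (* Renamings of [z] that are idle on [t] stay idle after [y] is renamed to [x], by [RnCm]; only
     the target [y] has to be excluded. *)
  case: zt => // zt; apply/frRnD.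
  move: (zt) => /frRnD/countableU/(_ (countable1 y)).
  apply: countable_subset => w /= nw; apply: contrapT => /not_orP[/=].
  move=> /contrapT tw /nesym wy; apply: nw.
  by rewrite rnCm ?tw.
- move=> t x z tx zt zx; have [y [ty yz _]] := unused _ _ _ (@countable0 _) zt.
  by have := rnVr _ _ y z tx; rewrite ty tx zx renvL => -[xy];
  apply: yz; rewrite zx.
- move=> t t1 t2 z tA /frRnD zt; split; apply/frRnD; apply: countable_subset zt.
    by move=> v /= + tv; have := rnAp _ _ _ v z tA; rewrite tv tA => -[<- _].
  by move=> v /= + tv; have := rnAp _ _ _ v z tA; rewrite tv tA => -[_ <-].
- move=> t K x t' z tK xK /frRnD zt; have [|/eqP/nesym zx] := eqVneq z x.
    by left.
  right; apply/frRnD; apply: countable_subset (countableU zt (countable1 x)) => v.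
  move=> /= nv; apply: contrapT => /not_orP[/= /contrapT tv /nesym vx]; apply: nv.
  have [K' []] := rnLm _ _ v z tK; rewrite tv tK => -[<-] /(_ _ _ xK).
  move=> /(_ vx zx) /(rnBvr _ _ _ _ _ _ tK xK)[_].
  by rewrite rnId.
Qed.

Lemma Props1_of_Props9 ren fr : Props9 (ren_fr_model dest ren fr) ->
  exists pm, Props1 (pm_fv_model dest pm (fun t => [set x | ~ fr x t])).
Proof.
rewrite /Props9 /Props1 /= => -[[rnVr rnAp rnLm] [[rnId rnChFr rnCm rnFr frRn]]].
move=> [[rnBvr rnBvr'] [frSup frVr frAp frLm]].
exists (perm_of_ren uncVar rnId rnChFr rnCm frRn frSup); split; split.
- exact: perm_of_ren_Vr.
- exact: perm_of_ren_Ap.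
- exact: perm_of_ren_Lm.
- exact: perm_of_ren_id.
- exact: perm_of_ren_comp.
- move=> t; apply/seteqP; split=> x /=; apply: contra_not => h.
    exact/(fr_iff_perm_of_ren uncVar rnId rnChFr rnCm rnFr frRn frSup).
  exact/(fr_iff_perm_of_ren uncVar rnId rnChFr rnCm rnFr frRn frSup).
- exact: perm_of_ren_Bvr.
Qed.

End Conversions.

(** * Corecursion into iterms *)

Section DtorMorphisms.
Variables (Var : eqType) (uncVar : ~ countable [set: Var]).
Variables (M : Type) (dest : M -> Defs.shape Var M).
Implicit Types (g h : M -> iterm Var) (m : M) (x y z : Var).

Definition dtor_morphism g := @preserves Var _ _ g s_dest dest (@idest Var).

(** The destructor of an iterm collects all its decompositions, so membership of [(x, g m')] is the
    equation [g m = iLm x (g m')], and sub-commutation becomes equational. *)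
Lemma dtor_morphismP g : dtor_morphism g <->
  [/\ forall m x, dest m = V M x -> g m = iVr x,
      forall m m1 m2, dest m = A _ m1 m2 -> g m = iAp (g m1) (g m2) &
      forall m K x m', dest m = L K -> sval K (x, m') -> g m = iLm x (g m')].
Proof.
split=> [H|[Hv Ha Hl] m].
  split=> [m x e|m m1 m2 e|m K x m' e xK]; have := H m; rewrite e.
  - by move/(idestV uncVar).
  - by move/(idestA uncVar).
  - by case=> K' [/(idestL uncVar) E /(_ _ _ xK) /E].
case e: (dest m) => [x|m1 m2|K].
- by apply/(idestV uncVar); exact: Hv e.
- by apply/(idestA uncVar); exact: Ha e.
have [[x m'] xK] := svalP K.
have [K' tK' K'E] := idest_Lm uncVar x (g m').
exists K'; rewrite (Hl _ _ _ _ e xK); split=> // y m1 /(Hl _ _ _ _ e) gm.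
by apply/K'E; rewrite -gm -(Hl _ _ _ _ e xK).
Qed.

Lemma dtor_morphism_unique g h : dtor_morphism g -> dtor_morphism h -> g = h.
Proof.
move=> /dtor_morphismP[gV gA gL] /dtor_morphismP[hV hA hL]; apply: funext => m.
apply: (@iterm_coind _ uncVar (fun t u => exists m, t = g m /\ u = h m)).
  move=> _ _ [{}m [-> ->]]; case e: (dest m) => [x|m1 m2|K].
  - by constructor 1; rewrite (gV _ _ e) (hV _ _ e).
  - constructor 2; exists (g m1), (g m2), (h m1), (h m2).
    by rewrite -(gA _ _ _ e) -(hA _ _ _ e); split=> //; [exists m1|exists m2].
  - have [[x m'] xK] := svalP K; constructor 3; exists x, (g m'), (h m').
    by rewrite -(gL _ _ _ _ e xK) -(hL _ _ _ _ e xK); split=> //; exists m'.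
by exists m.
Qed.

(** Serves laws that prescribe only the destructor of a result, as [SbVr] does at the substituted
    variable. *)
Lemma dtor_morphism_dest g m1 m2 : dtor_morphism g ->
  dest m1 = dest m2 -> g m1 = g m2.
Proof.
move=> /dtor_morphismP[gV gA gL]; case e: (dest m2) => [x|n1 n2|K] e1.
- by rewrite (gV _ _ e) (gV _ _ e1).
- by rewrite (gA _ _ _ e) (gA _ _ _ e1).
- have [[x m'] xK] := svalP K.
  by rewrite (gL _ _ _ _ e xK) (gL _ _ _ _ e1 xK).
Qed.

(* By uniqueness: conjugating [g] by the permutation gives a morphism again. *)
Lemma dtor_morphism_perm g (pm : M -> perm Var -> M) :
  PmVr dest pm -> PmAp dest pm -> PmLm dest pm -> dtor_morphism g ->
  forall m r, g (pm m r) = iperm (g m) r.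
Proof.
move=> pmVr pmAp pmLm gM m r; have [q [rK qK]] := perm_inverse r.
have [gV gA gL] := (dtor_morphismP g).1 gM.
have gE : (fun m => iperm (g (pm m r)) q) = g.
  apply: dtor_morphism_unique gM; apply/dtor_morphismP; split.
  - by move=> n x /pmVr-/(_ r) /gV ->; rewrite iperm_Vr // rK.
  - by move=> n n1 n2 /pmAp-/(_ r) /gA ->; rewrite iperm_Ap.
  - move=> n K x n' /pmLm-/(_ r)[K' [/gL nK' KK']] /KK' /nK' ->.
    by rewrite iperm_Lm // rK.
rewrite -[in RHS]gE iperm_comp // (_ : perm_comp r q = perm_id Var).
  by rewrite iperm_id.
by apply: eq_perm => v; apply: qK.
Qed.

(** One decomposition per abstraction that avoids [z] and [s] is enough, because coinduction on
    iterms compares bodies under one common binder. [act] stands for renaming or substitution with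
    fixed arguments. *)
Lemma dtor_morphism_subst g (f : iterm Var -> iterm Var -> Var -> iterm Var)
    (act : M -> M) s z : is_subst f -> dtor_morphism g ->
  (forall m x, dest m = V M x ->
     if x == z then g (act m) = s else dest (act m) = V M x) ->
  (forall m m1 m2, dest m = A _ m1 m2 -> dest (act m) = A _ (act m1) (act m2)) ->
  (forall m K, dest m = L K -> exists x m' K', [/\ sval K (x, m'), x <> z,
     ifresh x s, dest (act m) = L K' & sval K' (x, act m')]) ->
  forall m, g (act m) = f (g m) s z.
Proof.
move=> [fV fA fL] /dtor_morphismP[gV gA gL] actV actA actL m.
apply: (@iterm_coind _ uncVar
  (fun t u => exists m, t = g (act m) /\ u = f (g m) s z)); last by exists m.
move=> _ _ [{}m [-> ->]]; case e: (dest m) => [x|m1 m2|K].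
- constructor 1; rewrite (gV _ _ e) fV; have := actV _ _ e.
  by case: eqP => // _ /gV.
- constructor 2; exists (g (act m1)), (g (act m2)), (f (g m1) s z), (f (g m2) s z).
  rewrite (gA _ _ _ e) fA (gA _ _ _ (actA _ _ _ e)).
  by split=> //; [exists m1|exists m2].
- have [x [m' [K' [xK xz xs mK' xK']]]] := actL _ _ e.
  constructor 3; exists x, (g (act m')), (f (g m') s z).
  rewrite (gL _ _ _ _ e xK) fL // (gL _ _ _ _ mK' xK').
  by split=> //; exists m'.
Qed.

Definition dtor_pick (K : {K : set (Var * M) | K !=set0}) : Var * M :=
  sval (cid (svalP K)).

CoFixpoint pre_corec m : preiterm Var :=
  match dest m with
  | V x => PVr x
  | A m1 m2 => PAp (pre_corec m1) (pre_corec m2)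
  | L K => PLm (dtor_pick K).1 (pre_corec (dtor_pick K).2)
  end.

Lemma pre_corecE m : pre_corec m = match dest m with
  | V x => PVr x
  | A m1 m2 => PAp (pre_corec m1) (pre_corec m2)
  | L K => PLm (dtor_pick K).1 (pre_corec (dtor_pick K).2)
  end.
Proof.
have frob p : p = match p with
    PVr x => PVr x | PAp p q => PAp p q | PLm x p => PLm x p end :> preiterm Var.
  by case: p.
by rewrite [LHS]frob /=; case: (dest m).
Qed.

Definition corec m : iterm Var := iclass (pre_corec m).

Lemma corecV m x : dest m = V M x -> corec m = iVr x.
Proof. by move=> e; rewrite /corec pre_corecE e. Qed.

Lemma corecA m m1 m2 : dest m = A _ m1 m2 -> corec m = iAp (corec m1) (corec m2).
Proof. by move=> e; rewrite /corec pre_corecE e iclass_PAp. Qed.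

Lemma corecL m K : dest m = L K ->
  exists x m', sval K (x, m') /\ corec m = iLm x (corec m').
Proof.
move=> e; exists (dtor_pick K).1, (dtor_pick K).2.
rewrite -surjective_pairing /corec pre_corecE e iclass_PLm //.
by split=> //; rewrite /dtor_pick; case: cid.
Qed.

Variables (sw : M -> Var -> Var -> M) (fr : Var -> M -> Prop).
Hypothesis Msw : Props5 (sw_fr_model dest sw fr).

Lemma corec_fr x m : fr x m -> ifresh x (corec m).
Proof.
move: Msw; rewrite /Props5 /= => -[_ [_ [_ [frVr frAp frLm]]]] xm.
apply: (@ifresh_coind _ uncVar x (fun t => exists m, t = corec m /\ fr x m)).
  move=> _ [{xm}m [-> xm]]; case e: (dest m) => [y|m1 m2|K].
  - constructor 1; rewrite (corecV e); apply/(ifresh_Vr uncVar).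
    exact: frVr e xm.
  - constructor 2; exists (corec m1), (corec m2); rewrite -(corecA e).
    by have [xm1 xm2] := frAp _ _ _ _ e xm; split=> //; [exists m1|exists m2].
  - have [y [m' [yK ->]]] := corecL e; constructor 3; exists y, (corec m').
    split=> //; case: (frLm _ _ _ _ _ e yK xm) => [|xm']; [by left|right].
    by exists m'.
by exists m.
Qed.

(** The decompositions picked for [m] and for its swap are chosen independently; [SwBvr] relates
    them by a further swap of the body, which the induction on positions absorbs because the swapped
    variables are quantified. *)
Lemma corec_sw m y z : corec (sw m y z) = iswap (corec m) y z.
Proof.
move: Msw; rewrite /Props5 /=.
move=> [[swVr swAp swLm] [[swId swIv swCp] [[swFr swBvr] _]]].
apply: (isem_inj uncVar) => w; rewrite isem_swap //.
elim: w m y z => [|b w IH] m y z; case e: (dest m) => [x|m1 m2|K].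
- by rewrite (corecV e) (corecV (swVr _ _ y z e)) !isem_Vr.
- by rewrite (corecA e) (corecA (swAp _ _ _ y z e)) !isem_Ap.
- have [x [m' [_ ->]]] := corecL e; have [K' [e' _]] := swLm _ _ y z e.
  by have [x' [m'' [_ ->]]] := corecL e'; rewrite !isem_Lm.
- by rewrite (corecV e) (corecV (swVr _ _ y z e)) !isem_Vr.
- by rewrite (corecA e) (corecA (swAp _ _ _ y z e)) !isem_Ap //; case: b.
have [x [m' [xK ->]]] := corecL e; have [K' [e' KK']] := swLm _ _ y z e.
have [v [n [vK' ->]]] := corecL e'; rewrite !isem_Lm //.
have [vm ->] := swBvr _ _ _ _ _ _ e' (KK' _ _ xK) vK'.
rewrite IH (lmap_bind _ _ (@swapv_inj _ y z)) -(IH m') bind_swap //.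
case: vm => [->|/corec_fr/ifreshP vm]; first by left.
by right.
Qed.

(** Any decomposition arises from the picked one by a swap with a harmless variable, and [corec]
    turns this into alpha-conversion of iterms. *)
Lemma corec_morphism : dtor_morphism corec.
Proof.
move: (Msw); rewrite /Props5 /= => -[_ [_ [[_ swBvr] _]]].
apply/dtor_morphismP; split; [exact: corecV|exact: corecA|].
move=> m K x m' e xK; have [y [n [yK ->]]] := corecL e.
have [xn ->] := swBvr _ _ _ _ _ _ e yK xK.
rewrite corec_sw; apply/(iLm_eq uncVar); split=> //.
by case: xn => [->|/corec_fr]; [left|right].
Qed.

End DtorMorphisms.

(** * Iterms as models *)

Section ItermModels.
Variables (Var : eqType) (uncVar : ~ countable [set: Var]).
Implicit Types (t u s : iterm Var) (x y z : Var) (r : perm Var).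

Lemma iFV_fr t x : iFV t x <-> ~ ifresh x t.
Proof. by []. Qed.

Lemma Props1_iterm : Props1 (pm_fv_model (@idest Var) (@iperm Var) (@iFV Var)).
Proof.
rewrite /Props1 /=; split; split.
- by move=> t x r /(idestV uncVar) ->; apply/(idestV uncVar)/iperm_Vr.
- by move=> t t1 t2 r /(idestA uncVar) ->; apply/(idestA uncVar)/iperm_Ap.
- move=> t K r tK; have [[x t'] xK] := svalP K.
  have [K' e K'E] := idest_Lm uncVar (r x) (iperm t' r); exists K'.
  have tE := (idestL uncVar tK _ _).1 xK; rewrite tE iperm_Lm //; split=> // y u.
  by move=> /(idestL uncVar tK) tu; apply/K'E; rewrite -!iperm_Lm // -tE -tu.
- exact: iperm_id.
- exact: iperm_comp.
- move=> t; apply/seteqP; split=> x /=; apply: contra_not => h.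
    (* A fresh [y] whose transposition with [x] is idle passes its freshness on to [x]. *)
    have [y /not_orP[/not_orP[ty yt] yx]] := uncountable_avoid uncVar
      (countableU (countableU h (ifresh_countable t)) (countable1 x)).
    move: ty yt => /= /contrapT ty /contrapT yt.
    have := (ifresh_perm uncVar y t (transp x y)).2 yt.
    by rewrite ty /= swapvR.
  apply: countable_subset (ifresh_countable t) => y /= ty yt; apply: ty.
  apply: iperm_fix => // v /= sv; apply: contrapT => nvt; apply: sv.
  by apply: swapv_id => e; apply: nvt; rewrite e.
- move=> s K x t x' t' sK /(idestL uncVar sK) sE /(idestL uncVar sK).
  rewrite sE => /(iLm_eq uncVar)[h ->]; split=> //.
  by case: h => [|h]; [left|right; apply].
Qed.

Lemma Props3_iterm : Props3 (sw_fv_model (@idest Var) (@iswap Var) (@iFV Var)).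
Proof. exact: Props3_of_Props1 Props1_iterm. Qed.

Lemma Props6_iterm : Props6 (sw_fr_model (@idest Var) (@iswap Var) (@ifresh Var)).
Proof. exact: (Props6_of_Props3 uncVar iFV_fr Props3_iterm). Qed.

Lemma Props5_iterm : Props5 (sw_fr_model (@idest Var) (@iswap Var) (@ifresh Var)).
Proof. exact: Props5_of_Props6 Props6_iterm. Qed.

Lemma Props2_iterm : Props2 (pm_fv_model (@idest Var) (@iperm Var) (@iFV Var)).
Proof.
have := Props1_iterm; have := Props5_iterm; rewrite /Props1 /Props2 /Props5 /=.
move=> [_ [_ [_ [frVr frAp frLm]]]] [[pmVr pmAp pmLm] [pmId pmCp fvD pmBvr]].
split=> //; split; split=> //.
- move=> t r rt; apply: iperm_fix => // x rx; apply: contrapT => nx.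
  by have : (set0 : set Var) x by rewrite -rt.
- by move=> t x /frVr tx xt; apply: tx xt _.
- by move=> t t1 t2 /frAp h x [] /= nx /h[].
- by move=> t K x t' tK xK z [/= nz zx] /(frLm _ _ _ _ _ tK xK)[].
Qed.

(* Substitution is corecursion from the model of formal substitutions: the pair
   [(t, Some (s, z))] stands for t[s/z], and [(t, None)] for t itself. *)
Definition closure := option (iterm Var * Var).
Implicit Types (o : closure) (m n : iterm Var * closure).

Definition closure_avoids o x : Prop :=
  if o is Some (s, z) then x <> z /\ ifresh x s else True.

Definition closure_swap o y z : closure :=
  if o is Some (s, v) then Some (iswap s y z, swapv y z v) else None.

(** A variable hit by the pending substitution is replaced by [s] before a step is made, so
    [subst_step] never has to look a variable up. *)
Definition subst_head m : iterm Var * closure :=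
  match m.2, idest m.1 with
  | Some (s, z), V x => if x == z then (s, None) else m
  | _, _ => m
  end.

(** Capture avoidance is built into the destructor: only decompositions whose binder avoids the
    pending substitution are offered. *)
Definition subst_binders m : set (Var * (iterm Var * closure)) :=
  [set p | [/\ p.2.2 = m.2, m.1 = iLm p.1 p.2.1 & closure_avoids m.2 p.1]].

(** The default [A _ m m] is never reached, since the variables to be avoided are countably many. *)
Definition subst_step m : Defs.shape Var (iterm Var * closure) :=
  match idest m.1 with
  | V x => V _ x
  | A t1 t2 => A _ (t1, m.2) (t2, m.2)
  | L _ => if pselect (subst_binders m !=set0) is left h
           then L (exist _ _ h) else A _ m m
  end.

Definition subst_dest m := subst_step (subst_head m).

Definition subst_sw m y z := (iswap m.1 y z, closure_swap m.2 y z).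

(** Only a sufficient condition for freshness in t[s/z]; [Props5], unlike [Props6], contains no
    equivalence about freshness. *)
Definition subst_fr x m := ifresh x m.1 /\ closure_avoids m.2 x.

Lemma closure_avoids_countable o : countable [set x | ~ closure_avoids o x].
Proof.
case: o => [[s z]|] /=; last first.
  by apply: countable_subset (@countable0 _) => x /=; apply.
apply: countable_subset (countableU (countable1 z) (ifresh_countable s)).
by move=> x /= /not_andP[/contrapT|]; [left|right].
Qed.

Lemma subst_stepV m x : subst_step m = V _ x <-> m.1 = iVr x.
Proof.
rewrite /subst_step; split=> [|->]; last by rewrite idest_Vr.
case: (iterm_case uncVar m.1) => [[y ->]|[t1 [t2 ->]]|[y [t ->]]].
- by rewrite idest_Vr // => -[->].
- by rewrite idest_Ap.
- by have [K -> _] := idest_Lm uncVar y t; case: pselect.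
Qed.

Lemma subst_step_Ap o t1 t2 : subst_step (iAp t1 t2, o) = A _ (t1, o) (t2, o).
Proof. by rewrite /subst_step idest_Ap. Qed.

Lemma subst_step_Lm x t o : exists2 K, subst_step (iLm x t, o) = L K &
  sval K = subst_binders (iLm x t, o).
Proof.
rewrite /subst_step; have [K -> _] := idest_Lm uncVar x t.
case: pselect => [h|[]]; first by eexists.
have [y [u [e /contrapT yo _]]] :=
  iLm_avoid uncVar x t (closure_avoids_countable o).
by exists (y, (u, o)).
Qed.

Lemma subst_stepA m m1 m2 : subst_step m = A _ m1 m2 ->
  [/\ m.1 = iAp m1.1 m2.1, m1.2 = m.2 & m2.2 = m.2].
Proof.
case: m => t o /=; case: (iterm_case uncVar t) => [[y ->]|[t1 [t2 ->]]|[y [u ->]]].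
- by rewrite /subst_step idest_Vr.
- by rewrite subst_step_Ap => -[<- <-].
- by have [K ->] := subst_step_Lm y u o.
Qed.

Lemma subst_stepL m K : subst_step m = L K -> sval K = subst_binders m.
Proof.
case: m => t o /=; case: (iterm_case uncVar t) => [[y ->]|[t1 [t2 ->]]|[y [u ->]]].
- by rewrite /subst_step idest_Vr.
- by rewrite subst_step_Ap.
- by have [K' -> <-] := subst_step_Lm y u o => -[<-].
Qed.

Lemma iswap_Vr x y z : iswap (iVr x) y z = iVr (swapv y z x).
Proof. exact: (iperm_Vr uncVar x (transp y z)). Qed.

Lemma iswap_Ap t u y z : iswap (iAp t u) y z = iAp (iswap t y z) (iswap u y z).
Proof. exact: (iperm_Ap uncVar t u (transp y z)). Qed.

Lemma iswap_Lm x t y z :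
  iswap (iLm x t) y z = iLm (swapv y z x) (iswap t y z).
Proof. exact: (iperm_Lm uncVar x t (transp y z)). Qed.

Lemma ifresh_swap x t y z : ifresh (swapv y z x) (iswap t y z) <-> ifresh x t.
Proof. exact: (ifresh_perm uncVar _ _ (transp y z)). Qed.

Lemma closure_avoids_swap o x y z :
  closure_avoids (closure_swap o y z) (swapv y z x) <-> closure_avoids o x.
Proof.
case: o => [[s v]|] //=; rewrite ifresh_swap.
by split=> -[xv xs]; split=> // e; apply: xv; rewrite ?e //; apply: swapv_inj e.
Qed.

Lemma subst_head_sw m y z : subst_head (subst_sw m y z) = subst_sw (subst_head m) y z.
Proof.
case: m => t [[s v]|] //; rewrite /subst_sw /subst_head /=.
case: (iterm_case uncVar t) => [[x ->]|[t1 [t2 ->]]|[x [u ->]]].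
- rewrite iswap_Vr !idest_Vr // (inj_eq (@swapv_inj _ y z)).
  by case: eqP => //= _; rewrite iswap_Vr.
- by rewrite iswap_Ap !idest_Ap //= iswap_Ap.
- rewrite iswap_Lm; have [K1 -> _] := idest_Lm uncVar x u.
  by have [K2 -> _] := idest_Lm uncVar (swapv y z x) (iswap u y z); rewrite /= iswap_Lm.
Qed.

Lemma subst_head_fr x m : subst_fr x m -> subst_fr x (subst_head m).
Proof.
case: m => t [[s v]|] // [/= xt [xv xs]]; rewrite /subst_head /=.
case: (idest t) => [y||] //=; case: eqP => // _; by split.
Qed.

Lemma Props5_subst : Props5 (sw_fr_model subst_dest subst_sw subst_fr).
Proof.
have := Props5_iterm; rewrite /Props5 /=.
move=> [_ [[swId swIv swCp] [[swFr swBvr] _]]].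
split; [split|split; [split|split; split]].
- move=> m x y z /subst_stepV hm; rewrite /subst_dest subst_head_sw.
  by apply/subst_stepV; rewrite /= hm iswap_Vr.
- move=> m m1 m2 y z /subst_stepA[hm h1 h2]; rewrite /subst_dest subst_head_sw.
  rewrite /subst_sw hm iswap_Ap subst_step_Ap -{1}h1 -h2.
  by rewrite h1 h2.
- move=> m K y z /[dup] mK /subst_stepL KE; rewrite /subst_dest subst_head_sw.
  have [[x n]] := svalP K; rewrite KE => -[/= e1 e2 e3].
  have [K' K'e K'E] := subst_step_Lm (swapv y z x) (iswap n.1 y z)
                         (closure_swap (subst_head m).2 y z).
  exists K'; rewrite {1}/subst_sw e2 iswap_Lm; split=> // v n'.
  move=> [/= d1 d2 d3]; rewrite K'E; split=> //=; first by rewrite d1.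
  - by rewrite -!iswap_Lm -e2 d2.
  - exact/closure_avoids_swap.
- by case=> t [[s v]|] z; rewrite /subst_sw /= ?swId ?swapvv.
- by case=> t [[s v]|] y z; rewrite /subst_sw /= ?swIv ?swapvK.
- case=> t [[s v]|] y z z1 z2; rewrite /subst_sw /= [in LHS]swCp //.
  by rewrite [in LHS](swCp s) (swapv_morph _ _ _ (@swapv_inj _ z1 z2)).
- case=> t [[s v]|] y z [/= yt] + [/= zt]; rewrite /subst_sw /= swFr //.
  by move=> [yv ys] [zv zs]; rewrite swFr // swapv_id //; apply: nesym.
- move=> m K x n x' n' /subst_stepL -> [/= e1 e2 e3] [/= d1 d2 d3].
  move: d2; rewrite e2 => /(iLm_eq uncVar)[xn n'E]; split.
    case: xn => [|xn]; [by left|right; split=> //].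
    by rewrite e1.
  rewrite [n']surjective_pairing n'E d1 /subst_sw e1; congr pair.
  case: (subst_head m).2 e3 d3 => [[s v]|] //= [xv xs] [x'v x's].
  by rewrite swFr // swapv_id //; apply: nesym.
- move=> m x z /subst_stepV mx /subst_head_fr[]; rewrite mx.
  by move=> /(ifresh_Vr uncVar).
- move=> m m1 m2 z /subst_stepA[hm h1 h2] /subst_head_fr[]; rewrite hm.
  by move=> /(ifresh_Ap uncVar)[]; rewrite /subst_fr h1 h2.
- move=> m K x n z /subst_stepL -> [/= e1 e2 e3] /subst_head_fr[]; rewrite e2.
  by move=> /(ifresh_Lm uncVar)[|zn]; [left|right; rewrite /subst_fr e1].
Qed.

(** The corecursion [g] reads closures back as iterms; [g_None] says that nothing happens once a
    substitution is spent, which settles the case of the substituted variable. *)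
Lemma ex_is_subst : exists f, @is_subst Var f.
Proof.
pose g := corec subst_dest.
have gM : dtor_morphism subst_dest g := corec_morphism uncVar Props5_subst.
have [gV gA gL] := (dtor_morphismP uncVar subst_dest g).1 gM.
have g_None t : g (t, None) = t.
  apply: (@iterm_coind _ uncVar (fun u v => u = g (v, None))); last by [].
  move=> _ {}t ->; case: (iterm_case uncVar t) => [[x ->]|[t1 [t2 ->]]|[x [u ->]]].
  - by constructor 1; apply: gV; apply/subst_stepV.
  - constructor 2; exists (g (t1, None)), (g (t2, None)), t1, t2; split=> //.
    by apply: gA; apply: subst_step_Ap.
  - constructor 3; exists x, (g (u, None)), u; split=> //.
    have [K e KE] := subst_step_Lm x u None.
    by apply: (gL _ K) => //; rewrite KE.
exists (fun t s z => g (t, Some (s, z))); split.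
- move=> x s z; case: eqVneq => [->|xz].
    rewrite -[RHS]g_None; apply: (dtor_morphism_dest uncVar gM).
    by rewrite /subst_dest {1}/subst_head /= idest_Vr // eqxx.
  apply: gV; rewrite /subst_dest /subst_head /= idest_Vr // (negPf xz).
  exact/subst_stepV.
- move=> t1 t2 s z; apply: gA.
  by rewrite /subst_dest /subst_head /= idest_Ap // subst_step_Ap.
- move=> x t s z xz xs; have [K e KE] := subst_step_Lm x t (Some (s, z)).
  apply: (gL _ K); last by rewrite KE.
  rewrite -e /subst_dest /subst_head /=.
  by have [K' -> _] := idest_Lm uncVar x t.
Qed.

Lemma isubstP : is_subst (@isubst Var).
Proof.
rewrite /isubst; case: pselect => [h|[]]; last exact: ex_is_subst.
exact: (svalP (cid h)).
Qed.

Lemma isubst_Vr x s z : isubst (iVr x) s z = if x == z then s else iVr x.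
Proof. by have [] := isubstP. Qed.

Lemma isubst_Vr_id x s z : x <> z -> isubst (iVr x) s z = iVr x.
Proof. by move=> /eqP/negPf xz; rewrite isubst_Vr xz. Qed.

Lemma isubst_Ap t1 t2 s z :
  isubst (iAp t1 t2) s z = iAp (isubst t1 s z) (isubst t2 s z).
Proof. by have [] := isubstP. Qed.

Lemma isubst_Lm x t s z : x <> z -> ifresh x s ->
  isubst (iLm x t) s z = iLm x (isubst t s z).
Proof. by have [_ _] := isubstP; apply. Qed.

End ItermModels.

(** * Substitution *)

Section Substitution.
Variables (Var : eqType) (uncVar : ~ countable [set: Var]).
Implicit Types (t u s : iterm Var) (x y z : Var).

(** Case analysis under the variable convention, so that substitutions of [s] and [u] for variables
    in [zs] pass under the binder. *)
Lemma iterm_case_avoid t (zs : seq Var) s u :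
  [\/ exists x, t = iVr x, exists t1 t2, t = iAp t1 t2
    | exists x t', [/\ t = iLm x t', x \notin zs, ifresh x s & ifresh x u]].
Proof.
case: (iterm_case uncVar t) => [|tA|[x [t' ->]]]; [by constructor 1|by constructor 2|].
have [y [t'' [-> /not_orP[/not_orP[yz ys] yu] _]]] := iLm_avoid uncVar x t'
  (countableU (countableU (countable_seq zs) (ifresh_countable s))
              (ifresh_countable u)).
constructor 3; exists y, t''; split=> //; [exact/negP|exact: contrapT|exact: contrapT].
Qed.

Lemma isubst_fr t s y : ifresh y t -> isubst t s y = t.
Proof.
move=> yt; apply: (@iterm_coind _ uncVar
  (fun a b => a = isubst b s y /\ ifresh y b)); last by [].
move=> _ {yt}t [-> yt].
case: (iterm_case_avoid t [:: y] s s) yt => [[x ->]|[t1 [t2 ->]]|[x [t' [-> + xs _]]]].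
- move=> /(ifresh_Vr uncVar) yx.
  by constructor 1; rewrite isubst_Vr_id //; apply: nesym.
- move=> /(ifresh_Ap uncVar)[h1 h2]; constructor 2.
  by exists (isubst t1 s y), (isubst t2 s y), t1, t2; rewrite isubst_Ap.
- rewrite inE => /eqP xy /(ifresh_Lm uncVar)[/esym//|yt']; constructor 3.
  by exists x, (isubst t' s y), t'; rewrite isubst_Lm.
Qed.

Lemma isubst_id t z : isubst t (iVr z) z = t.
Proof.
apply: (@iterm_coind _ uncVar (fun a b => a = isubst b (iVr z) z)); last by [].
move=> _ {}t ->; case: (iterm_case_avoid t [:: z] (iVr z) (iVr z)) =>
  [[x ->]|[t1 [t2 ->]]|[x [t' [-> + xs _]]]].
- by constructor 1; rewrite isubst_Vr //; case: eqP => // ->.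
- constructor 2; exists (isubst t1 (iVr z) z), (isubst t2 (iVr z) z), t1, t2.
  by rewrite isubst_Ap.
- rewrite inE => /eqP xz; constructor 3; exists x, (isubst t' (iVr z) z), t'.
  by rewrite isubst_Lm.
Qed.

Lemma isubst_chain t s x1 x2 : ifresh x2 t ->
  isubst (isubst t (iVr x2) x1) s x2 = isubst t s x1.
Proof.
move=> x2t; apply: (@iterm_coind _ uncVar (fun a b => exists t, [/\ ifresh x2 t,
  a = isubst (isubst t (iVr x2) x1) s x2 & b = isubst t s x1]));
  last by exists t.
move=> _ _ [{x2t}t [x2t -> ->]].
case: (iterm_case_avoid t [:: x1; x2] (iVr x2) s) x2t =>
  [[x ->]|[t1 [t2 ->]]|[x [t' [-> + xs xu]]]].
- move=> /(ifresh_Vr uncVar) x2x; constructor 1; rewrite !isubst_Vr //.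
  case: eqP => _; first by rewrite isubst_Vr // eqxx.
  by rewrite isubst_Vr_id //; apply: nesym.
- move=> /(ifresh_Ap uncVar)[h1 h2]; constructor 2; rewrite !isubst_Ap //.
  by do 4!eexists; split; [reflexivity|reflexivity|exists t1|exists t2].
- rewrite !inE => /norP[/eqP xx1 /eqP xx2] /(ifresh_Lm uncVar)[/esym//|x2t'].
  constructor 3; rewrite !isubst_Lm //.
  by do 3!eexists; split; [reflexivity|reflexivity|exists t'].
Qed.

Lemma isubst_comm t s u x y : x <> y -> ifresh y s -> ifresh x u ->
  isubst (isubst t s x) u y = isubst (isubst t u y) s x.
Proof.
move=> xy ys xu; apply: (@iterm_coind _ uncVar (fun a b => exists t,
  a = isubst (isubst t s x) u y /\ b = isubst (isubst t u y) s x));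
  last by exists t.
move=> _ _ [{}t [-> ->]]; case: (iterm_case_avoid t [:: x; y] s u) =>
  [[z ->]|[t1 [t2 ->]]|[z [t' [-> + zs zu]]]].
- constructor 1; rewrite !(@isubst_Vr _ uncVar z); case: (eqVneq z x) => [->|/eqP zx].
    by case: eqP => // _; rewrite isubst_Vr // eqxx isubst_fr.
  rewrite isubst_Vr //; case: eqP => [_|_]; first by rewrite isubst_fr.
  by rewrite isubst_Vr_id.
- constructor 2; rewrite !isubst_Ap //.
  by do 4!eexists; split; [reflexivity|reflexivity|exists t1|exists t2].
- rewrite !inE => /norP[/eqP zx /eqP zy]; constructor 3; rewrite !isubst_Lm //.
  by do 3!eexists; split; [reflexivity|reflexivity|exists t'].
Qed.

Lemma ifresh_subst t s y z :
  ifresh z (isubst t s y) <-> (z = y \/ ifresh z t) /\ (ifresh y t \/ ifresh z s).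
Proof.
split=> [zt|[zt]].
  split.
    have [|/eqP zy] := eqVneq z y; [by left|right].
    apply: (@ifresh_coind _ uncVar z (fun t => ifresh z (isubst t s y))) => // {zt}t.
    case: (iterm_case_avoid t [:: y; z] s s) => [[x ->]|[t1 [t2 ->]]|[x [t' [-> + xs _]]]].
    - rewrite isubst_Vr //; case: eqP => [-> _|_ h]; constructor 1 => //.
      exact/(ifresh_Vr uncVar).
    - rewrite isubst_Ap // => /(ifresh_Ap uncVar)[h1 h2].
      by constructor 2; exists t1, t2.
    - rewrite !inE => /norP[/eqP xy /eqP xz]; rewrite isubst_Lm //.
      by move=> /(ifresh_Lm uncVar) h; constructor 3; exists x, t'.
  have [|zs] := pselect (ifresh z s); [by right|left].
  apply: (@ifresh_coind _ uncVar y (fun t => ifresh z (isubst t s y))) => // {zt}t.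
  case: (iterm_case_avoid t [:: y; z] s s) => [[x ->]|[t1 [t2 ->]]|[x [t' [-> + xs _]]]].
  - rewrite isubst_Vr //; case: eqP => [_ /zs//|xy _]; constructor 1.
    by apply/(ifresh_Vr uncVar); apply: nesym.
  - rewrite isubst_Ap // => /(ifresh_Ap uncVar)[h1 h2].
    by constructor 2; exists t1, t2.
  - rewrite !inE => /norP[/eqP xy /eqP xz]; rewrite isubst_Lm //.
    move=> /(ifresh_Lm uncVar)[/esym//|h]; constructor 3; exists x, t'.
    by split=> //; right.
case=> [yt|zs].
  by rewrite isubst_fr //; case: zt => // ->.
apply: (@ifresh_coind _ uncVar z (fun v => exists t,
  v = isubst t s y /\ (z = y \/ ifresh z t))); last by exists t.
move=> _ [{zt}t [-> zt]].
case: (iterm_case_avoid t [:: y; z] s s) zt => [[x ->]|[t1 [t2 ->]]|[x [t' [-> + xs _]]]].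
- move=> zt; constructor 1; rewrite isubst_Vr //; case: eqP => // xy.
  apply/(ifresh_Vr uncVar); case: zt => [->|/(ifresh_Vr uncVar)//].
  exact: nesym.
- move=> zt; constructor 2; rewrite isubst_Ap //.
  exists (isubst t1 s y), (isubst t2 s y); split=> //; [exists t1|exists t2];
  by split=> //; case: zt => [|/(ifresh_Ap uncVar)[]]; [left|right].
- rewrite !inE => /norP[/eqP xy /eqP xz] zt; rewrite isubst_Lm //.
  constructor 3; exists x, (isubst t' s y); split=> //; right; exists t'; split=> //.
  by case: zt => [|/(ifresh_Lm uncVar)[/esym//|]]; [left|right].
Qed.

(** Links substitution with the swapping of alpha-conversion, so that [SbBvr] and its converse
    follow from the binder law for swapping. *)
Lemma isubst_swap t x y : y = x \/ ifresh y t ->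
  isubst t (iVr y) x = iswap t y x.
Proof.
case=> [->|yt].
  by rewrite isubst_id iswapE transpvv iperm_id.
apply: (@iterm_coind _ uncVar (fun a b => exists t, [/\ ifresh y t,
  a = isubst t (iVr y) x & b = iswap t y x])); last by exists t.
move=> _ _ [{yt}t [yt -> ->]].
case: (iterm_case_avoid t [:: x; y] (iVr y) (iVr y)) yt =>
  [[z ->]|[t1 [t2 ->]]|[z [t' [-> + zs _]]]].
- move=> /(ifresh_Vr uncVar)/nesym zy; constructor 1; rewrite iswap_Vr //.
  rewrite isubst_Vr //; case: eqP => [->|zx]; first by rewrite swapvR.
  by rewrite swapv_id.
- move=> /(ifresh_Ap uncVar)[h1 h2]; constructor 2; rewrite isubst_Ap // iswap_Ap //.
  by do 4!eexists; split; [reflexivity|reflexivity|exists t1|exists t2].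
- rewrite !inE => /norP[/eqP zx /eqP zy] /(ifresh_Lm uncVar)[/esym//|yt'].
  constructor 3; rewrite isubst_Lm // iswap_Lm // swapv_id //.
  by do 3!eexists; split; [reflexivity|reflexivity|exists t'].
Qed.

Lemma Props7_iterm :
  Props7 (sb_fr_model (@idest Var) (@iVr Var) (@isubst Var) (@ifresh Var)).
Proof.
have := Props5_iterm uncVar; rewrite /Props5 /Props7 /=.
move=> [_ [_ [[_ swBvr] [frVr frAp frLm]]]].
split; split.
- move=> t s x z /(idestV uncVar) ->; rewrite isubst_Vr //.
  by case: ifP => // _; rewrite idest_Vr.
- by move=> t t1 t2 s z /(idestA uncVar) ->; rewrite isubst_Ap // idest_Ap.
- move=> t K s z tK.
  case: (iterm_case_avoid t [:: z] s s) (tK) =>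
    [[x ->]|[t1 [t2 ->]]|[x [t' [tE + xs _]]]].
  + by rewrite idest_Vr.
  + by rewrite idest_Ap.
  rewrite inE => /eqP xz _.
  have [K' e K'E] := idest_Lm uncVar x (isubst t' s z); exists K'.
  rewrite tE isubst_Lm //; split=> // y u /(idestL uncVar tK) tyu yz ys.
  by apply/K'E; rewrite -!isubst_Lm // -tE -tyu.
- split.
  + exact: isubst_id.
  + by move=> t s x1 x2; apply: isubst_chain.
  + by move=> t s u x y; apply: isubst_comm.
  + by move=> t s y; apply: isubst_fr.
  + by move=> t s y z; apply: ifresh_subst.
- split; first split.
  + move=> s K x t x' t' sK xK x'K.
    by have [h ->] := swBvr _ _ _ _ _ _ sK xK x'K; rewrite isubst_swap.
  + move=> s K x t x' sK /(idestL uncVar sK) sE x't; apply/(idestL uncVar sK).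
    by rewrite isubst_swap ?sE; [apply/(iLm_eq uncVar); split=> //; right|right].
  split; first by split=> // t; apply: ifresh_countable.
  split; first by move=> t x; apply: idestV.
  by move=> x z zx; apply/(ifresh_Vr uncVar).
Qed.

Lemma Props9_iterm :
  Props9 (ren_fr_model (@idest Var) (@irename Var) (@ifresh Var)).
Proof. exact: Props9_of_Props7 Props7_iterm. Qed.

Lemma Props8_iterm :
  Props8 (ren_fr_model (@idest Var) (@irename Var) (@ifresh Var)).
Proof. exact: (Props8_of_Props9 uncVar Props9_iterm). Qed.

Lemma Props_iterm i : Props (@Tr Var (Sigma i)).
Proof.
case: i; [exact: Props1_iterm|exact: Props2_iterm|exact: Props3_iterm|
          exact: Props5_iterm|exact: Props6_iterm|exact: Props7_iterm|
          exact: Props8_iterm|exact: Props9_iterm].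
Qed.

End Substitution.

(** * Finality and strength *)

Section Finality.
Variables (Var : eqType) (uncVar : ~ countable [set: Var]).
Variables (M : Type) (dest : M -> Defs.shape Var M).

Lemma morphism_of_Props5 sw fr : Props5 (sw_fr_model dest sw fr) ->
  exists g, [/\ dtor_morphism dest g,
    forall m y z, g (sw m y z) = iswap (g m) y z &
    forall x m, fr x m -> ifresh x (g m)].
Proof.
move=> Msw; exists (corec dest); split; first exact: corec_morphism Msw.
  by move=> m y z; apply: corec_sw Msw _ _ _.
by move=> x m; apply: corec_fr Msw _ _.
Qed.

Lemma morphism_of_Props3 sw fv : Props3 (sw_fv_model dest sw fv) ->
  exists g, [/\ dtor_morphism dest g,
    forall m y z, g (sw m y z) = iswap (g m) y z &
    forall m, @iFV Var (g m) `<=` fv m].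
Proof.
have fvE t x : fv t x <-> ~ ~ fv t x by split=> [h nh|/contrapT//]; apply: nh.
move=> /(Props6_of_Props3 uncVar fvE)/Props5_of_Props6/morphism_of_Props5.
move=> [g [gM gsw gfr]]; exists g; split=> // m x; apply: contra_notP.
exact: gfr.
Qed.

Lemma morphism_of_Props1 pm fv : Props1 (pm_fv_model dest pm fv) ->
  exists g, [/\ dtor_morphism dest g,
    forall m r, g (pm m r) = iperm (g m) r &
    forall m, @iFV Var (g m) `<=` fv m].
Proof.
move=> Mpm; have [[pmVr pmAp pmLm] _] := Mpm.
have [g [gM _ gfv]] := morphism_of_Props3 (Props3_of_Props1 Mpm).
exists g; split=> // m r.
exact: (dtor_morphism_perm uncVar pmVr pmAp pmLm gM).
Qed.

Lemma morphism_of_Props2 pm fv : Props2 (pm_fv_model dest pm fv) ->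
  exists g, [/\ dtor_morphism dest g,
    forall m r, g (pm m r) = iperm (g m) r &
    forall m, @iFV Var (g m) `<=` fv m].
Proof.
move=> Mpm; have [[pmVr pmAp pmLm] _] := Mpm.
have [g [gM _ gfr]] := morphism_of_Props5 (Props5_of_Props2 Mpm).
exists g; split=> // [m r|m x]; first
  exact: (dtor_morphism_perm uncVar pmVr pmAp pmLm gM).
by apply: contra_notP; apply: gfr.
Qed.

(** Passing to permutations forgets renaming and substitution; that the morphism respects them is
    recovered later by [dtor_morphism_subst]. *)
Lemma fr_morphism_of_Props9 ren fr : Props9 (ren_fr_model dest ren fr) ->
  exists g, dtor_morphism dest g /\ forall x m, fr x m -> ifresh x (g m).
Proof.
move=> /(Props1_of_Props9 uncVar)[pm /morphism_of_Props1[g [gM _ gfr]]].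
exists g; split=> // x m xm; apply: contrapT => nx.
by case: (gfr _ _ nx).
Qed.

Lemma morphism_of_Props9 ren fr : Props9 (ren_fr_model dest ren fr) ->
  exists g, [/\ dtor_morphism dest g,
    forall m y z, g (ren m y z) = irename (g m) y z &
    forall x m, fr x m -> ifresh x (g m)].
Proof.
move=> /[dup] /fr_morphism_of_Props9[g [gM gfr]]; rewrite /Props9 /=.
move=> [[rnVr rnAp rnLm] [_ [[_ rnBvr'] [frSup _ _ _]]]].
exists g; split=> // m y z.
apply: (dtor_morphism_subst uncVar (act := fun m => ren m y z)
          (isubstP uncVar) gM).
- move=> {}m x /rnVr-/(_ y z) h; case: eqP h => [->|xz]; last by rewrite renv_id.
  by have [gV _ _] := (dtor_morphismP uncVar _ _).1 gM; rewrite renvL => /gV.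
- by move=> {}m m1 m2; apply: rnAp.
move=> {}m K mK; have [[x m'] xK] := svalP K.
(* [FSupFr] provides a [v] fresh for the body and different from [y] and [z], and [RnBvr'] makes it
   the binder of a decomposition in [K]. *)
have [v /not_orP[/contrapT vm' /negP]] := uncountable_avoid uncVar
  (countableU (frSup m') (countable_seq [:: y; z])).
rewrite !inE => /norP[/eqP vy /eqP vz]; have [K' [e KK']] := rnLm _ _ y z mK.
have vK := rnBvr' _ _ _ _ _ mK xK vm'.
exists v, (ren m' v x), K'; split=> //; last exact: KK'.
exact/(ifresh_Vr uncVar).
Qed.

Lemma morphism_of_Props7 vr sb fr : Props7 (sb_fr_model dest vr sb fr) ->
  exists g, [/\ dtor_morphism dest g, forall x, g (vr x) = iVr x,
    forall m n z, g (sb m n z) = isubst (g m) (g n) z &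
    forall x m, fr x m -> ifresh x (g m)].
Proof.
move=> /[dup] /Props9_of_Props7/fr_morphism_of_Props9[g [gM gfr]].
rewrite /Props7 /= => -[[sbVr sbAp sbLm] [_ [[_ sbBvr']]]].
move=> [[frSup _ _ _] [vrInv _]].
have [gV _ _] := (dtor_morphismP uncVar _ _).1 gM.
exists g; split=> // [x|m n z]; first by apply: gV; apply/vrInv.
apply: (dtor_morphism_subst uncVar (act := fun m => sb m n z)
          (isubstP uncVar) gM).
- move=> {}m x /sbVr-/(_ n z); case: ifP => // _ e.
  exact: (dtor_morphism_dest uncVar gM).
- by move=> {}m m1 m2; apply: sbAp.
move=> {}m K mK; have [[x m'] xK] := svalP K.
have [v /not_orP[/not_orP[/contrapT vm' /contrapT vn] vz]] :=
  uncountable_avoid uncVar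
    (countableU (countableU (frSup m') (frSup n)) (countable1 z)).
have [K' [e KK']] := sbLm _ _ n z mK.
have vK := sbBvr' _ _ _ _ _ mK xK vm'.
by exists v, (sb m' (vr v) x), K'; split=> //; [exact: gfr|exact: KK'].
Qed.

End Finality.

Section Strength.
Variables (Var : eqType) (uncVar : ~ countable [set: Var]).

Lemma base_hom_unique (b : base_cat Var) (g h : hom b (base_obj Var)) : g = h.
Proof.
apply: mod_homP; exact: (@dtor_morphism_unique _ uncVar _
  (@op _ _ (sval b) s_dest isT) (sval g) (sval h)
  (svalP g s_dest isT) (svalP h s_dest isT)).
Qed.

Lemma ex_morphism i (M : model Var (Sigma i)) : Props M ->
  exists g : M -> iterm Var, @is_morphism Var _ M (Tr Var (Sigma i)) g.
Proof.
case: i M => M H.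
- have [g [gM gpm gfv]] := @morphism_of_Props1 _ uncVar M
    (@op _ _ M s_dest isT) (@op _ _ M s_pm isT) (@op _ _ M s_fv isT) H.
  by exists g => s hs; case: s hs => // hs; rewrite (bool_irrelevance hs isT).
- have [g [gM gpm gfv]] := @morphism_of_Props2 _ uncVar M
    (@op _ _ M s_dest isT) (@op _ _ M s_pm isT) (@op _ _ M s_fv isT) H.
  by exists g => s hs; case: s hs => // hs; rewrite (bool_irrelevance hs isT).
- have [g [gM gsw gfv]] := @morphism_of_Props3 _ uncVar M
    (@op _ _ M s_dest isT) (@op _ _ M s_sw isT) (@op _ _ M s_fv isT) H.
  by exists g => s hs; case: s hs => // hs; rewrite (bool_irrelevance hs isT).
- have [g [gM gsw gfr]] := @morphism_of_Props5 _ uncVar M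
    (@op _ _ M s_dest isT) (@op _ _ M s_sw isT) (@op _ _ M s_fr isT) H.
  by exists g => s hs; case: s hs => // hs; rewrite (bool_irrelevance hs isT).
- have [g [gM gsw gfr]] := @morphism_of_Props5 _ uncVar M
    (@op _ _ M s_dest isT) (@op _ _ M s_sw isT) (@op _ _ M s_fr isT)
    (Props5_of_Props6 H).
  by exists g => s hs; case: s hs => // hs; rewrite (bool_irrelevance hs isT).
- have [g [gM gvr gsb gfr]] := @morphism_of_Props7 _ uncVar M
    (@op _ _ M s_dest isT) (@op _ _ M s_vr isT) (@op _ _ M s_sb isT)
    (@op _ _ M s_fr isT) H.
  by exists g => s hs; case: s hs => // hs; rewrite (bool_irrelevance hs isT).
- have [g [gM grn gfr]] := @morphism_of_Props9 _ uncVar M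
    (@op _ _ M s_dest isT) (@op _ _ M s_ren isT) (@op _ _ M s_fr isT)
    (Props9_of_Props8 uncVar H).
  by exists g => s hs; case: s hs => // hs; rewrite (bool_irrelevance hs isT).
- have [g [gM grn gfr]] := @morphism_of_Props9 _ uncVar M
    (@op _ _ M s_dest isT) (@op _ _ M s_ren isT) (@op _ _ M s_fr isT) H.
  by exists g => s hs; case: s hs => // hs; rewrite (bool_irrelevance hs isT).
Qed.

Lemma final_iterm i (hJ : @Props Var i (@Tr Var (Sigma i))) : final_object (J hJ).
Proof.
move=> c; have [g gM] := ex_morphism (svalP c).
pose h : hom c (J hJ) := exist _ g gM.
exists h => k; apply: mod_homP.
have hs : Sigma i s_dest by case: (i).
exact: (@dtor_morphism_unique _ uncVar _ (@op _ _ (sval c) s_dest hs)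
  (sval k) (sval h) (svalP k s_dest hs) (svalP h s_dest hs)).
Qed.

(** Definability asks for an equality of reducts as objects, while a conversion only keeps the
    destructor; this bridges the two. *)
Lemma dtor_model_eq (T : Type) (o1 o2 : forall s, sig_dtor s -> interp Var s T) :
  o1 s_dest isT = o2 s_dest isT ->
  @Model Var sig_dtor T o1 = @Model Var sig_dtor T o2.
Proof.
move=> e; congr Model; apply: functional_extensionality_dep => s.
apply: functional_extensionality_dep => hs; case: s hs => // hs.
by rewrite (bool_irrelevance hs isT).
Qed.

Lemma stronger_of_conversion i j
    (hJi : @Props Var i (@Tr Var (Sigma i))) (hi : final_object (J hJi))
    (hJj : @Props Var j (@Tr Var (Sigma j))) (hj : final_object (J hJj)) :
  (forall M : model Var (Sigma i), Props M ->
     exists2 o : forall s, Sigma j s -> interp Var s M, Props (Model o) &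
       forall h h', o s_dest h = op M h') ->
  epicorec hj >=cr epicorec hi.
Proof.
(* The equation defining [g] is dropped: [g] equals the morphism induced by the converted model,
   whatever the casts, since both run from [b] to the base object. *)
move=> H b g [[M PM] [e _]]; have [o PN oE] := H M PM.
have dc : R Var j (exist _ (Model o) PN) = R Var i (exist _ M PM).
  by apply: (congr1 (fun m => exist _ m I)); apply: dtor_model_eq.
exists (exist _ (Model o) PN), (etrans dc e); exact: base_hom_unique.
Qed.

End Strength.

Theorem mainTheorem8 (Var : eqType) (HVar : has_card_aleph1 Var) :
  exists (hJ : forall i : cr_index, @Props Var i (@Tr Var (Sigma i)))
         (hfin : forall i : cr_index, final_object (J (hJ i))),
    let cr (i : cr_index) : epi_corecursor (base_obj Var) := epicorec (hfin i) in
    [/\ cr i2 =cr= cr i5, cr i5 >=cr cr i6, cr i6 >=cr cr i3,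
        cr i3 =cr= cr i1 & cr i1 >=cr cr i8] /\
    [/\ cr i5 >=cr cr i9, cr i9 >=cr cr i7 & cr i9 >=cr cr i8].
Proof.
have [uncVar _] := HVar.
exists (Props_iterm uncVar), (fun i => final_iterm uncVar _) => cr.
have op_dest i (M : model Var (Sigma i)) (h h' : Sigma i s_dest) : op M h = op M h'.
  by rewrite (bool_irrelevance h h').
have trans i j k : cr i >=cr cr j -> cr j >=cr cr k -> cr i >=cr cr k.
  by move=> ij jk b g /jk /ij.
have ge52 : cr i5 >=cr cr i2.
  apply: (stronger_of_conversion uncVar) => M H; eexists.
    exact: (@Props5_of_Props2 _ M (@op _ _ M s_dest isT) (@op _ _ M s_pm isT)
              (@op _ _ M s_fv isT) H).
  by move=> h h'; apply: op_dest.
have ge25 : cr i2 >=cr cr i5.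
  apply: (stronger_of_conversion uncVar) => M H.
  have [pm PM] := @Props2_of_Props5 _ M (@op _ _ M s_dest isT)
    (@op _ _ M s_sw isT) (@op _ _ M s_fr isT) H.
  by eexists; [exact: PM|move=> h h'; apply: op_dest].
have ge56 : cr i5 >=cr cr i6.
  apply: (stronger_of_conversion uncVar) => M H; eexists.
    exact: (@Props5_of_Props6 _ M (@op _ _ M s_dest isT) (@op _ _ M s_sw isT)
              (@op _ _ M s_fr isT) H).
  by move=> h h'; apply: op_dest.
have ge63 : cr i6 >=cr cr i3.
  apply: (stronger_of_conversion uncVar) => M H; eexists.
    apply: (@Props6_of_Props3 _ uncVar M (@op _ _ M s_dest isT)
      (@op _ _ M s_sw isT) (@op _ _ M s_fv isT)
      (fun x t => ~ @op _ _ M s_fv isT t x)) H.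
    by move=> t x; split=> [h nh|/contrapT//]; apply: nh.
  by move=> h h'; apply: op_dest.
have ge31 : cr i3 >=cr cr i1.
  apply: (stronger_of_conversion uncVar) => M H; eexists.
    exact: (@Props3_of_Props1 _ M (@op _ _ M s_dest isT) (@op _ _ M s_pm isT)
              (@op _ _ M s_fv isT) H).
  by move=> h h'; apply: op_dest.
have ge13 : cr i1 >=cr cr i3.
  apply: (stronger_of_conversion uncVar) => M H.
  have [pm PM] := @Props1_of_Props3 _ M (@op _ _ M s_dest isT)
    (@op _ _ M s_sw isT) (@op _ _ M s_fv isT) H.
  by eexists; [exact: PM|move=> h h'; apply: op_dest].
have ge19 : cr i1 >=cr cr i9.
  apply: (stronger_of_conversion uncVar) => M H.
  have [pm PM] := @Props1_of_Props9 _ uncVar M (@op _ _ M s_dest isT)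
    (@op _ _ M s_ren isT) (@op _ _ M s_fr isT) H.
  by eexists; [exact: PM|move=> h h'; apply: op_dest].
have ge98 : cr i9 >=cr cr i8.
  apply: (stronger_of_conversion uncVar) => M H; eexists.
    exact: (@Props9_of_Props8 _ uncVar M (@op _ _ M s_dest isT)
              (@op _ _ M s_ren isT) (@op _ _ M s_fr isT) H).
  by move=> h h'; apply: op_dest.
have ge97 : cr i9 >=cr cr i7.
  apply: (stronger_of_conversion uncVar) => M H; eexists.
    exact: (@Props9_of_Props7 _ M (@op _ _ M s_dest isT) (@op _ _ M s_vr isT)
              (@op _ _ M s_sb isT) (@op _ _ M s_fr isT) H).
  by move=> h h'; apply: op_dest.
(* [cr i5] reaches [cr i9] by way of 6, 3 and 1, and [cr i1] reaches [cr i8] by way of 9. *)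
have ge53 := trans _ _ _ ge56 ge63; have ge51 := trans _ _ _ ge53 ge31.
by split; split=> //; [exact: trans ge19 ge98|exact: trans ge51 ge19].
Qed.
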